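(* For every $\bm{p}=(p_1,p_2)$ with $p_1,p_2$ positive integers, there is a constant $c=c_{\bm{p}}>0$ such that, if $Q:\mathcal{V}_{\mathrm{tri}}\to\mathbb{R}$ is $\bm{p}$-periodic and $\|Q\|_\infty\le c$, then the following hold for $H_Q=\Delta_{\mathrm{tri}}+Q$: (1) $\sigma(H_Q)$ consists of no more than two intervals. (2) If at least one of $p_1$ or $p_2$ is odd, then $\sigma(H_Q)$ consists of a single interval. Moreover, the gap in the first setting may only open at the energy $E=-2$; that is, for every $\varepsilon>0$ there is $\delta\in(0,c]$ such that whenever $Q$ is $\bm{p}$-periodic with $\|Q\|_\infty\le\delta$, every bounded connected component of $\mathbb{R}\setminus\sigma(H_Q)$ is contained in $(-2-\varepsilon,-2+\varepsilon)$.
   Context: Triangular lattice: let $\bm{a}_1=(1,0)$, $\bm{a}_2=\frac12(1,\sqrt3)$ in $\mathbb{R}^2$ and $\mathcal{V}_{\mathrm{tri}}=\{n\bm{a}_1+m\bm{a}_2:n,m\in\mathbb{Z}\}$; vertices $u,v$ are neighbors, $u\sim v$, iff their Euclidean distance is $1$ (so each vertex has six neighbors). The Laplacian $\Delta_{\mathrm{tri}}$ is the bounded self-adjoint operator on $\ell^2(\mathcal{V}_{\mathrm{tri}})$ given by $[\Delta_{\mathrm{tri}}\psi]_u=\sum_{v\sim u}\psi_v$ (the adjacency operator). A bounded function $Q:\mathcal{V}_{\mathrm{tri}}\to\mathbb{R}$ acts by multiplication, $[Q\psi]_u=Q(u)\psi_u$. $Q$ is $(p_1,p_2)$-periodic if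 $Q(u+p_1\bm{a}_1)=Q(u+p_2\bm{a}_2)=Q(u)$ for all $u\in\mathcal{V}_{\mathrm{tri}}$. $\sigma$ denotes spectrum. *)

(* Defs.v *)
From mathcomp Require Import all_boot all_order all_algebra.
From mathcomp Require Import all_classical all_reals all_analysis.
From mathcomp Require Import complex.

Set Implicit Arguments.
Unset Strict Implicit.
Unset Printing Implicit Defensive.

Import Order.TTheory GRing.Theory Num.Theory.
Import numFieldNormedType.Exports.

Local Open Scope classical_set_scope.
Local Open Scope ring_scope.
Local Open Scope complex_scope.

Section TriangularLattice.
Variable R : realType.

Definition tri_a1 : R * R := (1, 0).
Definition tri_a2 : R * R := (2^-1, Num.sqrt 3 / 2).

(* As a1 and a2 are linearly independent, (n, m) |-> n a1 + m a2 is a bijection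
   from int * int onto the triangular lattice; int * int is its vertex type. *)
Definition tri_vertex : Type := (int * int)%type.

Definition tri_pos (u : tri_vertex) : R * R := tri_a1 *~ u.1 + tri_a2 *~ u.2.

(* The library norm on R * R is the sup norm, hence the explicit formula. *)
Definition euclid_dist (x y : R * R) : R :=
  Num.sqrt ((x.1 - y.1) ^+ 2 + (x.2 - y.2) ^+ 2).

Definition tri_adj (u v : tri_vertex) : Prop :=
  euclid_dist (tri_pos u) (tri_pos v) = 1.

Definition l2_sqnorm (psi : tri_vertex -> R[i]) : \bar R :=
  \esum_(u in [set: tri_vertex])
    (complex.Re (psi u) ^+ 2 + complex.Im (psi u) ^+ 2)%:E.

Definition l2 : set (tri_vertex -> R[i]) :=
  [set psi | (l2_sqnorm psi < +oo)%E].

(* Operators on l2 are represented by maps on all functions, of which only the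
   restriction to l2 is ever constrained. *)
Definition operator : Type := (tri_vertex -> R[i]) -> (tri_vertex -> R[i]).

(* The last condition implies that A maps l2 to itself. *)
Definition bounded_operator (A : operator) : Prop :=
  (forall (a : R[i]) (phi psi : tri_vertex -> R[i]), l2 phi -> l2 psi ->
     A (fun u => a * phi u + psi u) = (fun u => a * A phi u + A psi u)) /\
  (exists M : R, forall psi : tri_vertex -> R[i], l2 psi ->
     (l2_sqnorm (A psi) <= (M ^+ 2)%:E * l2_sqnorm psi)%E).

Definition resolvent_set (A : operator) : set R[i] :=
  [set z | exists B : operator, bounded_operator B /\
     forall psi : tri_vertex -> R[i], l2 psi ->
       B (fun u => A psi u - z * psi u) = psi /\
       (fun u => A (B psi) u - z * B psi u) = psi].

Definition spectrum (A : operator) : set R[i] := ~` resolvent_set A.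

(* \sum_(v \in _) is the sum over a finite set (it would be 0 on an infinite
   support); here the index set is the set of the six neighbors of u. *)
Definition tri_laplacian : operator :=
  fun psi u => \sum_(v \in [set v | tri_adj u v]) psi v.

Definition schrodinger (Q : tri_vertex -> R) : operator :=
  fun psi u => tri_laplacian psi u + (Q u)%:C * psi u.

Definition tri_periodic (p1 p2 : nat) (Q : tri_vertex -> R) : Prop :=
  forall u : tri_vertex,
    Q (u.1 + p1%:Z, u.2) = Q u /\ Q (u.1, u.2 + p2%:Z) = Q u.

Definition sup_norm (Q : tri_vertex -> R) : \bar R :=
  ereal_sup [set `|Q u|%:E | u in [set: tri_vertex]].

Definition segment (a b : R) : set R[i] := [set x%:C | x in `[a, b]].

Definition is_one_interval (S : set R[i]) : Prop :=
  exists a b : R, a < b /\ S = segment a b.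

(* The two intervals are allowed to overlap or coincide. *)
Definition at_most_two_intervals (S : set R[i]) : Prop :=
  exists a b a' b' : R,
    [/\ a < b, a' < b' & S = segment a b `|` segment a' b'].

Definition real_complement (S : set R[i]) : set R := [set x | ~ S x%:C].

End TriangularLattice.

(* Main.v *)
Require Import Defs.
From mathcomp Require Import all_boot all_order all_algebra.
From mathcomp Require Import all_classical all_reals all_analysis.
From mathcomp Require Import complex.
From mathcomp Require Import ring lra zify.

(** The operator [H_Q] splits into finite hermitian Bloch kernels indexed by the
    quasi-momentum [k]. Its spectrum is the union of the ranges (the bands) of
    their ordered eigenvalues, which by Weyl's inequality move by at most [|Q|].
    A band lies in the spectrum because a bounded inverse would force the mass of
    a Bloch wave in a box to grow exponentially with the box, whereas it grows
    quadratically; off the bands, [H_Q - z] is inverted on finite tori with a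
    uniform bound, and the inverses converge along an ultrafilter.

    It remains to see that consecutive bands of the free operator overlap in an
    interval, except perhaps at [-2]. If they were separated by [E], the number
    of free eigenvalues below [E] would not depend on [k]. These eigenvalues are
    the values of the dispersion relation at finitely many shifts of [k]. For
    [E <> -2], eliminating a variable shows that two shifts of the level curve
    [E] meet in finitely many points, so that [k] can cross a single one of them,
    which changes the count by one. At [-2] the dispersion relation factors into
    three cosines and the level curve is made of lines; crossing one of them
    changes the count if [p1] or [p2] is odd. Finally, no free band is flat, so
    that at most one pair of consecutive bands can touch at [-2]. *)

Set Implicit Arguments.
Unset Strict Implicit.
Unset Printing Implicit Defensive.

Import Order.TTheory GRing.Theory Num.Theory.
Import numFieldNormedType.Exports.

Local Open Scope complex_scope.
Local Open Scope classical_set_scope.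
Local Open Scope ring_scope.

(** * Hermitian kernels on a finite type *)

Section FiniteSpectral.
Variable R : realType.
Local Notation C := R[i].

Definition sqmod (z : C) : R := complex.Re z ^+ 2 + complex.Im z ^+ 2.

Lemma conjE (z : C) : z^* = conjc z.
Proof. by []. Qed.

Lemma sqmodE z : (sqmod z)%:C = z * z^*.
Proof. rewrite conjE; by case: z => a b; rewrite /sqmod; simpc => /=; congr (_ +i* _); ring.
    Qed.

Lemma sqmod_ge0 z : 0 <= sqmod z.
Proof. by rewrite addr_ge0 ?sqr_ge0. Qed.

Lemma sqmod_eq0 z : sqmod z = 0 -> z = 0.
Proof.
case: z => a b /= /eqP; rewrite /sqmod /= paddr_eq0 ?sqr_ge0 // !sqrf_eq0.
by case/andP=> /eqP -> /eqP ->.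
Qed.

Lemma sqmod0 : sqmod 0 = 0.
Proof. by rewrite /sqmod /= expr0n addr0. Qed.

Lemma sqmodM z w : sqmod (z * w) = sqmod z * sqmod w.
Proof. by case: z w => a b [c d]; rewrite /sqmod; simpc => /=; ring. Qed.

Lemma sqmod_real (x : R) : sqmod x%:C = x ^+ 2.
Proof. by rewrite /sqmod /= expr0n addr0. Qed.

Lemma sqmodN z : sqmod (- z) = sqmod z.
Proof. by case: z => a b; rewrite /sqmod /= !sqrrN. Qed.

Lemma sqmodD_le z w : sqmod (z + w) <= 2 * sqmod z + 2 * sqmod w.
Proof.
case: z w => a b [c d]; rewrite /sqmod /=.
have := sqr_ge0 (a - c); have := sqr_ge0 (b - d); nra.
Qed.

Variable T : finType.
Implicit Types (f g : T -> C) (K : T -> T -> C) (e : T -> T -> C).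

Definition inner f g : C := \sum_t f t * (g t)^*.
Definition sqnorm f : R := \sum_t sqmod (f t).
Definition kernel_app K f : T -> C := fun r => \sum_c K r c * f c.

Definition hermitian_kernel K := forall r c, K r c = (K c r)^*.

Definition diagonalizes K (d : T -> R) e :=
  [/\ forall i j, inner (e i) (e j) = (i == j)%:R,
      forall r s, \sum_i e i r * (e i s)^* = (r == s)%:R
    & forall i r, kernel_app K (e i) r = (d i)%:C * e i r].

Lemma sqnormE f : (sqnorm f)%:C = inner f f.
Proof. by rewrite /sqnorm rmorph_sum; apply: eq_bigr => t _; exact: sqmodE. Qed.

Lemma spectral_kernel K : hermitian_kernel K ->
  exists d e, diagonalizes K d e.
Proof.
move=> hK.
pose M := (\matrix_(i < #|T|, j < #|T|) K (enum_val j) (enum_val i)) : 'M[C]_#|T|.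
have hM : M \is hermsymmx.
  rewrite qualifE expr0 scale1r; apply/eqP/matrixP => i j; rewrite !mxE.
  by rewrite hK.
have := hermitian_spectral_diag_real hM.
have /hermitian_normalmx/orthomx_spectralP := hM.
have := spectral_unitarymx M.
move: (spectralmx M) (spectral_diag M) => U D Uu ME Dr.
have Uv := invmx_unitary Uu.
have UM : U *m M = diag_mx D *m U.
  by rewrite {1}ME !mulmxA mulmxV ?mul1mx // unitarymx_unit.
have /unitarymxP U1 := Uu.
have U2 : map_mx Num.conj U^T *m U = 1%:M by rewrite -Uv mulVmx // unitarymx_unit.
exists (fun i => complex.Re (D 0 (enum_rank i))).
exists (fun i t => U (enum_rank i) (enum_rank t)); split.
- move=> i j; have /matrixP/(_ (enum_rank i) (enum_rank j)) := U1.
  rewrite !mxE (inj_eq enum_rank_inj) => <-.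
  rewrite /inner (reindex _ (onW_bij _ (@enum_val_bij T))).
  by apply: eq_bigr => k _; rewrite !mxE enum_valK.
- move=> r s; have /matrixP/(_ (enum_rank s) (enum_rank r)) := U2.
  rewrite !mxE (inj_eq enum_rank_inj) eq_sym => <-.
  rewrite (reindex _ (onW_bij _ (@enum_val_bij T))).
  by apply: eq_bigr => k _; rewrite !mxE enum_valK mulrC.
- move=> i r; have /matrixP/(_ (enum_rank i) (enum_rank r)) := UM.
  rewrite mul_diag_mx !mxE RRe_real; last exact: (mxOverP Dr).
  move=> <-; rewrite /kernel_app (reindex _ (onW_bij _ (@enum_val_bij T))).
  by apply: eq_bigr => k _; rewrite !mxE enum_valK enum_rankK mulrC.
Qed.

Section Diagonalized.
Variables (K : T -> T -> C) (d : T -> R) (e : T -> T -> C).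
Hypothesis Kde : diagonalizes K d e.

Lemma basis_expansion f r : f r = \sum_i inner f (e i) * e i r.
Proof.
have [_ ecomp _] := Kde.
rewrite /inner; under eq_bigr do rewrite mulr_suml.
rewrite exchange_big /=.
under eq_bigr => t _.
  under eq_bigr => i _ do rewrite -mulrA [X in _ * X]mulrC.
  rewrite -mulr_sumr ecomp.
  over.
rewrite (bigD1 r) //= eqxx mulr1 big1 ?addr0 // => t /negPf.
by rewrite eq_sym => ->; rewrite mulr0.
Qed.

Lemma sqnorm_comb (a : T -> C) : sqnorm (fun r => \sum_i a i * e i r) = \sum_i sqmod (a i).
Proof.
have [eort _ _] := Kde.
apply: (@complexI R); rewrite sqnormE rmorph_sum /= /inner.
under [LHS]eq_bigr => t _ do rewrite mulr_suml.
rewrite exchange_big /=; apply: eq_bigr => i _.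
under [LHS]eq_bigr => t _ do rewrite rmorph_sum mulr_sumr.
rewrite exchange_big /= (bigD1 i) //= [X in _ + X]big1 ?addr0 => [|j ji].
  have e1 : inner (e i) (e i) = 1 by rewrite eort eqxx.
  rewrite sqmodE -[RHS]mulr1 -e1.
  by rewrite /inner mulr_sumr; apply: eq_bigr => t _; rewrite rmorphM /=; ring.
transitivity (a i * (a j)^* * inner (e i) (e j)).
  by rewrite /inner mulr_sumr; apply: eq_bigr => t _; rewrite rmorphM /=; ring.
by rewrite eort eq_sym (negPf ji) mulr0.
Qed.

Lemma parseval f : sqnorm f = \sum_i sqmod (inner f (e i)).
Proof.
rewrite -(sqnorm_comb (fun i => inner f (e i))) /sqnorm; apply: eq_bigr => t _.
by rewrite -basis_expansion.
Qed.

Lemma kernel_app_comb (a : T -> C) r :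
  kernel_app K (fun s => \sum_i a i * e i s) r = \sum_i (d i)%:C * a i * e i r.
Proof.
have [_ _ eig] := Kde.
rewrite /kernel_app; under eq_bigr do rewrite mulr_sumr.
rewrite exchange_big /=; apply: eq_bigr => i _.
transitivity (a i * kernel_app K (e i) r); last by rewrite eig; ring.
by rewrite /kernel_app mulr_sumr; apply: eq_bigr => c _; ring.
Qed.

Lemma inner_comb (a : T -> C) i : inner (fun s => \sum_j a j * e j s) (e i) = a i.
Proof.
have [eort _ _] := Kde.
rewrite /inner; under eq_bigr do rewrite mulr_suml.
rewrite exchange_big /= (bigD1 i) //= [X in _ + X]big1 ?addr0 => [|j ji].
  have e1 : inner (e i) (e i) = 1 by rewrite eort eqxx.
  transitivity (a i * inner (e i) (e i)); last by rewrite e1 mulr1.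
  by rewrite /inner mulr_sumr; apply: eq_bigr => t _; rewrite mulrA.
transitivity (a j * inner (e j) (e i)).
  by rewrite /inner mulr_sumr; apply: eq_bigr => t _; rewrite mulrA.
by rewrite eort (negPf ji) mulr0.
Qed.

Lemma kernel_appE f r : kernel_app K f r = \sum_i (d i)%:C * inner f (e i) * e i r.
Proof.
rewrite -kernel_app_comb /kernel_app; apply: eq_bigr => c _; congr (_ * _).
exact: basis_expansion.
Qed.

Lemma inner_kernel_app f i : inner (kernel_app K f) (e i) = (d i)%:C * inner f (e i).
Proof.
rewrite -(inner_comb (fun i => (d i)%:C * inner f (e i)) i) /inner.
by apply: eq_bigr => t _; rewrite kernel_appE.
Qed.

Lemma kernel_app_form f : inner (kernel_app K f) f = (\sum_i d i * sqmod (inner f (e i)))%:C.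
Proof.
rewrite rmorph_sum /= {1}/inner.
under [LHS]eq_bigr => t _ do rewrite kernel_appE mulr_suml.
rewrite exchange_big /=; apply: eq_bigr => i _.
rewrite rmorphM /= sqmodE {3}/inner rmorph_sum mulrA.
move: (inner f (e i)) => u; rewrite mulr_sumr; apply: eq_bigr => t _.
by rewrite rmorphM /= conjCK; ring.
Qed.

Lemma eigenvalue_diag f (l : R) : (exists r, f r != 0) ->
  (forall r, kernel_app K f r = l%:C * f r) -> exists i, d i = l.
Proof.
move=> [r0 fr0] Kf; apply/not_existsP => dl.
have fi i : inner f (e i) = 0.
  apply/eqP; have := inner_kernel_app f i.
  have -> : inner (kernel_app K f) (e i) = l%:C * inner f (e i).
    by rewrite /inner mulr_sumr; apply: eq_bigr => t _; rewrite Kf mulrA.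
  move/eqP; rewrite -subr_eq0 -mulrBl -rmorphB mulf_eq0.
  case/orP => // /eqP /complexI/eqP; rewrite subr_eq0 => /eqP E.
  by case: (dl i).
by move: fr0; rewrite (basis_expansion f r0) big1 ?eqxx // => i _; rewrite fi mul0r.
Qed.

Lemma shifted_sqnorm_ge f (z : C) (delta : R) :
  (forall i, delta <= sqmod ((d i)%:C - z)) ->
  delta * sqnorm f <= sqnorm (fun r => kernel_app K f r - z * f r).
Proof.
move=> hd.
have -> : sqnorm (fun r => kernel_app K f r - z * f r) =
    sqnorm (fun r => \sum_i (((d i)%:C - z) * inner f (e i)) * e i r).
  apply: eq_bigr => r _; congr sqmod; rewrite kernel_appE (basis_expansion f r).
  rewrite mulr_sumr -sumrB; apply: eq_bigr => i _; ring.
rewrite sqnorm_comb parseval mulr_sumr; apply: ler_sum => i _.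
by rewrite sqmodM ler_wpM2r ?sqmod_ge0.
Qed.

Lemma shifted_solve g (z : C) (delta : R) : 0 < delta ->
  (forall i, delta <= sqmod ((d i)%:C - z)) ->
  exists f, (forall r, kernel_app K f r - z * f r = g r).
Proof.
move=> d0 hd; have dz i : (d i)%:C - z != 0.
  apply/eqP => E; move: (hd i); rewrite E sqmod0 leNgt d0 //.
exists (fun r => \sum_i (inner g (e i) / ((d i)%:C - z)) * e i r) => r.
rewrite kernel_app_comb mulr_sumr -sumrB [RHS]basis_expansion.
by apply: eq_bigr => i _; field; exact: dz.
Qed.

End Diagonalized.

Lemma nontrivial_relation (A B : {pred T}) (G : T -> T -> C) : (#|B| < #|A|)%N ->
  exists a : T -> C, [/\ exists i, a i != 0, forall i, i \notin A -> a i = 0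
    & forall j, j \in B -> \sum_i a i * G i j = 0].
Proof.
move=> BA.
pose M := (\matrix_(i < #|A|, j < #|B|) G (enum_val i) (enum_val j)) : 'M[C]_(_, _).
have kM : kermx M != 0.
  rewrite -mxrank_eq0 mxrank_ker subn_eq0 -ltnNge.
  exact: leq_ltn_trans (rank_leq_col _) BA.
have /rowV0Pn [v /sub_kermxP vM v0] := kM.
have /rV0Pn [i0 vi0] := v0.
pose a t := if insub t is Some u then
  v 0 (enum_rank_in (enum_valP i0) (val (u : {t | t \in A}))) else 0.
have aE i : a (enum_val i) = v 0 i.
  by rewrite /a insubT ?enum_valP // => h /=; rewrite enum_valK_in.
exists a; split.
- by exists (enum_val i0); rewrite aE.
- by move=> i iA; rewrite /a insubN.
- move=> j jB.
  have /rowP/(_ (enum_rank_in jB j)) := vM; rewrite !mxE => vMj.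
  rewrite -[RHS]vMj (bigID (mem A)) /= [X in _ + X]big1 ?addr0 => [|i iA]; last first.
    by rewrite /a insubN ?mul0r.
  rewrite big_enum_val /=; apply: eq_bigr => i _.
  by rewrite aE !mxE enum_rankK_in.
Qed.

Definition num_lt (d : T -> R) (E : R) : nat := #|[pred i | d i < E]|.

Lemma weyl_count K K' d e d' e' (c E : R) :
  diagonalizes K d e -> diagonalizes K' d' e' ->
  (forall f, complex.Re (inner (kernel_app K' f) f) <= complex.Re (inner (kernel_app K f) f) +
      c * sqnorm f) ->
  (num_lt d E <= num_lt d' (E + c))%N.
Proof.
move=> D D' h; rewrite leqNgt; apply/negP => lt.
have [a [[i0 ai0] aA aB]] := nontrivial_relation (fun i j => inner (e i) (e' j)) lt.
pose w r := \sum_i a i * e i r.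
have we' j : inner w (e' j) = \sum_i a i * inner (e i) (e' j).
  rewrite /inner /w; under eq_bigr do rewrite mulr_suml.
  rewrite exchange_big /=; apply: eq_bigr => i _; rewrite mulr_sumr.
  by apply: eq_bigr => t _; rewrite mulrA.
have := h w; rewrite (kernel_app_form D) (kernel_app_form D') /=.
apply/negP; rewrite -ltNge.
have nw : sqnorm w = \sum_i sqmod (a i) by rewrite (sqnorm_comb D).
apply: (@lt_le_trans _ _ ((E + c) * sqnorm w)).
  rewrite mulrDl ltrD2r nw mulr_sumr.
  have {}hlt i : a i != 0 -> d i < E.
    by move=> ai; have := contra_neqT (aA i) ai; rewrite inE.
  have term i : d i * sqmod (inner w (e i)) <= E * sqmod (a i).
    rewrite (inner_comb D); have [->|/hlt/ltW ai] := eqVneq (a i) 0.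
      by rewrite sqmod0 !mulr0.
    by rewrite ler_wpM2r ?sqmod_ge0.
  rewrite (bigD1 i0) //= [ltRHS](bigD1 i0) //= ltr_leD ?ler_sum //.
  rewrite (inner_comb D) ltr_pM2r ?hlt // lt_def sqmod_ge0 andbT.
  by apply: contra_neq ai0 => /sqmod_eq0.
rewrite (parseval D') mulr_sumr; apply: ler_sum => j _.
have [jd|jd] := ltP (d' j) (E + c).
  have -> : inner w (e' j) = 0 by rewrite we' aB // inE.
  by rewrite sqmod0 !mulr0.
by rewrite ler_wpM2r ?sqmod_ge0.
Qed.

End FiniteSpectral.

Section SortedEigenvalues.
Variable R : realType.
Local Notation C := R[i].
Variable T : finType.
Implicit Types (d : T -> R) (K : T -> T -> C).

Definition num_le d (E : R) : nat := #|[pred i | d i <= E]|.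
Definition sorted_value d (k : nat) : R := nth 0 (sort <=%R [seq d i | i <- enum T]) k.

Let sorted_values d : sorted <=%R (sort <=%R [seq d i | i <- enum T]).
Proof. exact: sort_le_sorted. Qed.

Let size_values d : size (sort <=%R [seq d i | i <- enum T]) = #|T|.
Proof. by rewrite size_sort size_map -cardE. Qed.

Let count_values d (P : pred R) :
  count P (sort <=%R [seq d i | i <- enum T]) = #|[pred i | P (d i)]|.
Proof.
by rewrite count_sort count_map cardE enumT /enum_mem size_filter; apply: eq_count.
Qed.

Lemma sorted_value_lt d k E : (k < #|T|)%N -> (sorted_value d k < E) = (k < num_lt d E)%N.
Proof.
move=> kT; rewrite /sorted_value /num_lt -(count_values d (fun x => x < E)).
apply/idP/idP => [|h]; last exact: nth_count_lt (sorted_values d) h.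
apply: contraTT; rewrite -leqNgt -leNgt => h.
by apply: nth_count_ge; rewrite ?sorted_values // h size_values.
Qed.

Lemma sorted_value_le d k E : (k < #|T|)%N -> (sorted_value d k <= E) = (k < num_le d E)%N.
Proof.
move=> kT; rewrite /sorted_value /num_le -(count_values d (fun x => x <= E)).
apply/idP/idP => [|h]; last exact: nth_count_le (sorted_values d) h.
apply: contraTT; rewrite -leqNgt -ltNge => h.
by apply: nth_count_gt; rewrite ?sorted_values // h size_values.
Qed.

Lemma sorted_value_mono d k l : (k <= l < #|T|)%N -> sorted_value d k <= sorted_value d l.
Proof.
move=> /andP[kl lT].
apply: (sorted_leq_nth le_trans le_refl); rewrite ?inE ?size_values //.
exact: leq_ltn_trans kl lT.
Qed.

Lemma sorted_value_mem d k : (k < #|T|)%N -> exists i, sorted_value d k = d i.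
Proof.
move=> kT; have : sorted_value d k \in sort <=%R [seq d i | i <- enum T].
  by rewrite mem_nth // size_values.
by rewrite mem_sort => /mapP[i _ ->]; exists i.
Qed.

Lemma mem_sorted_value d i : exists2 k, (k < #|T|)%N & sorted_value d k = d i.
Proof.
have : d i \in sort <=%R [seq d i | i <- enum T].
  by rewrite mem_sort map_f // mem_enum.
by move=> /(nthP 0)[k]; rewrite size_values => kT <-; exists k.
Qed.

Lemma weyl_sorted_value K K' d e d' e' (c : R) k : (k < #|T|)%N ->
  diagonalizes K d e -> diagonalizes K' d' e' ->
  (forall f, complex.Re (inner (kernel_app K' f) f) <= complex.Re (inner (kernel_app K f) f) +
      c * sqnorm f) ->
  sorted_value d' k <= sorted_value d k + c.
Proof.
move=> kT D D' h; rewrite leNgt; apply/negP; rewrite -ltrBrDr => lt.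
have := weyl_count (sorted_value d' k - c) D D' h; rewrite subrK.
move: lt; rewrite sorted_value_lt // => /leq_trans lt /lt.
by rewrite -sorted_value_lt // ltxx.
Qed.

Definition eigenval K (k : nat) : R :=
  sorted_value (xget (fun=> 0) [set d | exists e, diagonalizes K d e]) k.

Lemma eigenval_sorted_value K : hermitian_kernel K ->
  exists d e, diagonalizes K d e /\ eigenval K = sorted_value d.
Proof.
move=> /spectral_kernel[d [e D]].
rewrite /eigenval; case: xgetP => [d' _ [e' D']|nex]; first by exists d', e'.
by case: (nex d); exists e.
Qed.

Lemma eigenval_diag K d e k : (k < #|T|)%N -> diagonalizes K d e -> eigenval K k = sorted_value
    d k.
Proof.
move=> kT D; rewrite /eigenval; case: xgetP => [d' _ [e' D']|nex]; last first.
  by case: (nex d); exists e.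
have h f : complex.Re (inner (kernel_app K f) f) <= complex.Re (inner (kernel_app K f) f) + 0 *
    sqnorm f.
  by rewrite mul0r addr0.
apply/eqP; rewrite eq_le.
have := weyl_sorted_value kT D D' h; have := weyl_sorted_value kT D' D h.
by rewrite !addr0 => -> ->.
Qed.

Lemma eigenval_mono K k l : (k <= l < #|T|)%N -> eigenval K k <= eigenval K l.
Proof. exact: sorted_value_mono. Qed.

Lemma eigenval_eigenvector K k : hermitian_kernel K -> (k < #|T|)%N ->
  exists f, (exists r, f r != 0) /\ forall r, kernel_app K f r = (eigenval K k)%:C * f r.
Proof.
move=> /eigenval_sorted_value[d [e [D ->]]] kT; have [eort _ eig] := D.
have [i ->] := sorted_value_mem d kT; exists (e i); split; last exact: eig.
apply/not_existsP => e0; have := eort i i; rewrite eqxx /inner big1 => [/eqP|t _].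
  by rewrite eq_sym oner_eq0.
by have /negP/negPn/eqP -> := e0 t; rewrite mul0r.
Qed.

Lemma eigenvalue_eigenval K f (l : R) : hermitian_kernel K -> (exists r, f r != 0) ->
  (forall r, kernel_app K f r = l%:C * f r) -> exists2 k, (k < #|T|)%N & eigenval K k = l.
Proof.
move=> /eigenval_sorted_value[d [e [D ->]]] f0 Kf.
by have [i <-] := eigenvalue_diag D f0 Kf; exact: mem_sorted_value.
Qed.

Lemma eigenval_close K K' (c : R) k : (k < #|T|)%N ->
  hermitian_kernel K -> hermitian_kernel K' ->
  (forall f, `|complex.Re (inner (kernel_app K' f) f) - complex.Re (inner (kernel_app K f) f)|
      <= c * sqnorm f) ->
  `|eigenval K' k - eigenval K k| <= c.
Proof.
move=> kT /eigenval_sorted_value[d [e [D ->]]] /eigenval_sorted_value[d' [e' [D' ->]]] h.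
rewrite ler_norml lerBlDl lerBrDl; apply/andP; split.
  rewrite lerBlDr; apply: (weyl_sorted_value kT D' D) => f.
  by have := h f; rewrite ler_norml => /andP[]; lra.
apply: (weyl_sorted_value kT D D') => f.
by have := h f; rewrite ler_norml => /andP[]; lra.
Qed.

Lemma Re_mul_le (w a b : C) (eta : R) : 0 <= eta -> sqmod w <= eta ^+ 2 ->
  `|complex.Re (w * a * b^*)| <= eta * ((sqmod a + sqmod b) / 2).
Proof.
move=> eta0 weta.
have := sqmod_ge0 a; have := sqmod_ge0 b => b0 a0.
have n2b : sqmod b^* = sqmod b by rewrite conjE; case: b {b0} => x y; rewrite /sqmod /= sqrrN.
have : complex.Re (w * a * b^*) ^+ 2 <= (eta * ((sqmod a + sqmod b) / 2)) ^+ 2.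
  apply: (@le_trans _ _ (sqmod (w * a * b^*))); first by rewrite lerDl sqr_ge0.
  rewrite !sqmodM n2b exprMn -mulrA ler_pM ?sqmod_ge0 ?mulr_ge0 //.
  have := sqr_ge0 (sqmod a - sqmod b); nra.
rewrite -ler_sqrt ?sqr_ge0 // !sqrtr_sqr => /le_trans; apply.
by rewrite ger0_norm // mulr_ge0 // divr_ge0 // addr_ge0.
Qed.

Lemma eigenval_entrywise K K' (eta : R) k : (k < #|T|)%N -> 0 <= eta ->
  hermitian_kernel K -> hermitian_kernel K' ->
  (forall r s, sqmod (K' r s - K r s) <= eta ^+ 2) ->
  `|eigenval K' k - eigenval K k| <= #|T|%:R * eta.
Proof.
move=> kT eta0 hK hK' h; apply: eigenval_close => // f.
have -> : complex.Re (inner (kernel_app K' f) f) - complex.Re (inner (kernel_app K f) f) =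
   \sum_r \sum_s complex.Re ((K' r s - K r s) * f s * (f r)^*).
  rewrite -raddfB /inner -sumrB raddf_sum; apply: eq_bigr => r _.
  rewrite -mulrBl /kernel_app -sumrB mulr_suml raddf_sum; apply: eq_bigr => s _.
  by rewrite -[in LHS]mulrBl.
apply: (@le_trans _ _ (\sum_r \sum_s eta * ((sqmod (f s) + sqmod (f r)) / 2))).
  apply: le_trans (ler_norm_sum _ _ _) _; apply: ler_sum => r _.
  apply: le_trans (ler_norm_sum _ _ _) _; apply: ler_sum => s _.
  exact: Re_mul_le.
have nE : sqnorm f = \sum_i sqmod (f i) by [].
under eq_bigr => r _.
  rewrite -mulr_sumr -mulr_suml big_split /= sumr_const -nE.
  over.
rewrite -mulr_sumr -mulr_suml big_split /= sumr_const sumrMnl -nE.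
move: (sqnorm f) #|T| => x n; rewrite -(mulr_natl x n).
rewrite le_eqVlt; apply/orP; left; apply/eqP; by field.
Qed.

End SortedEigenvalues.

(** * Bloch kernels on the triangular lattice *)

Section Lattice.
Variable R : realType.
Local Notation C := R[i].
Local Notation V := (int * int)%type.

Definition expi (x : R) : C := (cos x +i* sin x)%C.

Lemma expi0 : expi 0 = 1.
Proof. by rewrite /expi cos0 sin0. Qed.

Lemma expiD x y : expi (x + y) = expi x * expi y.
Proof. by rewrite /expi cosD sinD; simpc; congr (_ +i* _)%C; ring. Qed.

Lemma expiN x : expi (- x) = (expi x)^*.
Proof. by rewrite /expi cosN sinN. Qed.

Lemma sqmod_expi x : sqmod (expi x) = 1.
Proof. exact: cos2Dsin2. Qed.

Lemma expi_neq0 x : expi x != 0.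
Proof. by apply/eqP => h; have := sqmod_expi x; rewrite h sqmod0 => /eqP; rewrite eq_sym
    oner_eq0. Qed.

Lemma expiNK x : expi (- x) * expi x = 1.
Proof. by rewrite -expiD addNr expi0. Qed.

Lemma expi_2pi_nat (n : nat) : expi (2 * pi * n%:R) = 1.
Proof.
elim: n => [|n IH]; first by rewrite mulr0 expi0.
rewrite -[n.+1%:R]natr1 mulrDr mulr1 expiD IH mul1r /expi.
by rewrite mulr_natl cos2pi sin2pi.
Qed.

Lemma expi_2pi (n : int) : expi (2 * pi * n%:~R) = 1.
Proof.
case: n => n; first exact: expi_2pi_nat.
by rewrite NegzE mulrNz mulrN expiN expi_2pi_nat rmorph1.
Qed.

Definition neighbors : seq V := [:: (1, 0); (-1, 0); (0, 1); (0, -1); (1, -1); (-1, 1)].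

Lemma tri_adjE (u v : V) : tri_adj R u v <-> v - u \in neighbors.
Proof.
rewrite /tri_adj /euclid_dist /tri_pos.
have -> : ((tri_a1 R *~ u.1 + tri_a2 R *~ u.2).1 - (tri_a1 R *~ v.1 + tri_a2 R *~ v.2).1) ^+ 2 +
   ((tri_a1 R *~ u.1 + tri_a2 R *~ u.2).2 - (tri_a1 R *~ v.1 + tri_a2 R *~ v.2).2) ^+ 2 =
   (let a := v.1 - u.1 in let b := v.2 - u.2 in a ^+ 2 + a * b + b ^+ 2)%:~R.
  have fstz (x : R * R) n : (x *~ n).1 = x.1 * n%:~R by rewrite mulrzr (raddfMz fst).
  have sndz (x : R * R) n : (x *~ n).2 = x.2 * n%:~R by rewrite mulrzr (raddfMz snd).
  rewrite /= !fstz !sndz /tri_a1 /tri_a2 /=.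
  rewrite !rmorphD !rmorphXn !rmorphM /= !rmorphB /=.
  set a : R := u.1%:~R; set b : R := u.2%:~R; set c : R := v.1%:~R; set d : R := v.2%:~R.
  have s3 : Num.sqrt 3 ^+ 2 = 3 :> R by rewrite sqr_sqrtr.
  have -> : (0 * a + Num.sqrt 3 / 2 * b - (0 * c + Num.sqrt 3 / 2 * d)) ^+ 2 =
    Num.sqrt 3 ^+ 2 * (b - d) ^+ 2 / 4 by field.
  by rewrite s3; field.
rewrite /=; case: u v => u1 u2 [v1 v2] /=.
have -> : ((v1, v2) - (u1, u2) : V) = (v1 - u1, v2 - u2) by [].
move: (v1 - u1) (v2 - u2) => a b.
have -> : (Num.sqrt ((a ^+ 2 + a * b + b ^+ 2)%:~R : R) = 1) <->
   a ^+ 2 + a * b + b ^+ 2 = 1.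
  split => [|->]; last by rewrite sqrtr1.
  move/(congr1 (fun x => x ^+ 2)); rewrite expr1n sqr_sqrtr => [/eqP|]; last first.
    rewrite ler0z; nia.
  by rewrite -[1](mulr1z 1) eqr_int => /eqP.
rewrite !inE !xpair_eqE; split => h; last first.
  by move: h; do ![case/orP]; case/andP => /eqP -> /eqP ->.
have ha : -1 <= a <= 1 by nia.
have hb : -1 <= b <= 1 by nia.
have : a = -1 \/ a = 0 \/ a = 1 by lia.
have : b = -1 \/ b = 0 \/ b = 1 by lia.
by move=> [|[|]] eb [|[|]] ea; subst.
Qed.

Lemma tri_laplacianE (psi : V -> C) u :
  tri_laplacian psi u = \sum_(v <- neighbors) psi (u + v).
Proof.
rewrite /tri_laplacian.
have -> : [set v | tri_adj R u v] = [set` [seq u + v | v <- neighbors]].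
  have lP v : v \in [seq u + v | v <- neighbors] <-> tri_adj R u v.
    rewrite tri_adjE; split => [/mapP[w hw ->]|h].
      by rewrite addrAC subrr add0r.
    by apply/mapP; exists (v - u) => //; rewrite addrC subrK.
  by apply/seteqP; split => v h; apply/lP.
rewrite -fsbig_seq ?big_map //.
by rewrite map_inj_uniq //; exact: addrI.
Qed.

Lemma schrodingerE Q (psi : V -> C) u :
  schrodinger Q psi u = \sum_(v <- neighbors) psi (u + v) + (Q u)%:C * psi u.
Proof. by rewrite /schrodinger tri_laplacianE. Qed.

Definition dotk (k : R * R) (u : V) : R := k.1 * u.1%:~R + k.2 * u.2%:~R.

Lemma dotkD k u v : dotk k (u + v) = dotk k u + dotk k v.
Proof. by rewrite /dotk /= !rmorphD /=; ring. Qed.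

Lemma dotkN k u : dotk k (- u) = - dotk k u.
Proof. by rewrite /dotk /= !rmorphN /=; ring. Qed.

Lemma dot0k u : dotk (0, 0) u = 0.
Proof. by rewrite /dotk !mul0r addr0. Qed.

Definition residue (p : nat) (hp : (0 < p)%N) (x : int) : 'I_p.
Proof. by exists `|(x %% p)%Z|%N; rewrite -ltz_nat gez0_abs ?modz_ge0 ?ltz_pmod //; lia.
    Defined.

Lemma residueE p (hp : (0 < p)%N) x : (residue hp x : nat)%:Z = (x %% p)%Z.
Proof. by rewrite /= gez0_abs // modz_ge0 //; lia. Qed.

Lemma periodicz {T : Type} (g : int -> T) (p : int) :
  (forall x, g (x + p) = g x) -> forall (k : int) x, g (x + k * p) = g x.
Proof.
move=> gp k x; have gn (n : nat) y : g (y + n%:Z * p) = g y.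
  elim: n y => [|n IH] y; first by rewrite mul0r addr0.
  by rewrite -(IH y) -(gp (y + n%:Z * p)); congr g; rewrite intS; ring.
case: k => n; first exact: gn.
rewrite NegzE -(gn n.+1 (x + _)); congr g; ring.
Qed.

Section Cell.
Variables (p1 p2 : nat).
Hypotheses (hp1 : (0 < p1)%N) (hp2 : (0 < p2)%N).

Definition cell := ('I_p1 * 'I_p2)%type.
Definition red (u : V) : cell := (residue hp1 u.1, residue hp2 u.2).
Definition emb (r : cell) : V := ((r.1 : nat)%:Z, (r.2 : nat)%:Z).

Lemma redP u v : red u = red v <-> (u.1 = v.1 %[mod p1])%Z /\ (u.2 = v.2 %[mod p2])%Z.
Proof.
rewrite -(residueE hp1) -(residueE hp1) -(residueE hp2) -(residueE hp2).
split => [E|[h1 h2]].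
  have E1 := congr1 (fun r : cell => ((r.1 : nat)%:Z)) E.
  by have E2 := congr1 (fun r : cell => ((r.2 : nat)%:Z)) E.
by congr pair; apply: val_inj => /=; apply/eqP; rewrite -eqz_nat; apply/eqP.
Qed.

Lemma redK : cancel emb red.
Proof.
move=> [[a ha] [b hb]]; rewrite /red /emb /=; congr pair; apply: val_inj => /=.
  by rewrite modz_small //; lia.
by rewrite modz_small //; lia.
Qed.

Lemma red_embD u v : red (emb (red u) + v) = red (u + v).
Proof.
apply/redP => /=; rewrite -[Posz _]/((residue hp1 u.1 : nat)%:Z) -[X in (X + v.2)%R]/((residue
    hp2 u.2 : nat)%:Z).
by rewrite !residueE !modzDml.
Qed.

Lemma red_embB r c v : red (emb r + v) = c -> red (emb c - v) = r.
Proof. by move=> <-; rewrite red_embD addrK redK. Qed.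

Lemma periodic_red {T : Type} (g : V -> T) :
  (forall u, g (u.1 + p1%:Z, u.2) = g u /\ g (u.1, u.2 + p2%:Z) = g u) ->
  forall u, g (emb (red u)) = g u.
Proof.
move=> gp u; rewrite /emb /red !residueE.
rewrite -(@periodicz _ (fun x => g (x, _)) p1%:Z _ (u.1 %/ p1)%Z); last first.
  by move=> x; have [/= -> _] := gp (x, (u.2 %% p2)%Z).
rewrite addrC -divz_eq.
rewrite -(@periodicz _ (fun x => g (_, x)) p2%:Z _ (u.2 %/ p2)%Z); last first.
  by move=> x; have [/= _ ->] := gp (u.1, x).
by rewrite addrC -divz_eq; case: u.
Qed.

(* Conjugating [H_Q] by [expi (dotk k u)] and letting it act on functions that
   are periodic modulo [(p1, p2)]. *)
Definition bloch_kernel (k : R * R) (Q : V -> R) : cell -> cell -> C := fun r c =>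
  \sum_(v <- neighbors) (red (emb r + v) == c)%:R * expi (dotk k v) + (Q (emb r))%:C * (r ==
      c)%:R.

Lemma bloch_kernel_hermitian k Q : hermitian_kernel (bloch_kernel k Q).
Proof.
move=> r c; rewrite /bloch_kernel rmorphD /=; congr (_ + _); last first.
  rewrite rmorphM /= rmorph_nat conjE conjc_real eq_sym.
  by have [->|] := eqVneq c r; rewrite ?mulr0.
have key v : (red (emb r + v) == c)%:R * expi (dotk k v) =
    ((red (emb c - v) == r)%:R * expi (dotk k (- v)))^*.
  rewrite rmorphM /= rmorph_nat dotkN expiN conjCK.
  suff -> : (red (emb r + v) == c) = (red (emb c - v) == r) by [].
  by apply/eqP/eqP => [/red_embB //|<-]; rewrite red_embD subrK redK.
rewrite (perm_big (map -%R neighbors)) // big_map rmorph_sum /=.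
by apply: eq_bigr => v _; rewrite key !opprK.
Qed.

Lemma kernel_app_bloch k Q f r : kernel_app (bloch_kernel k Q) f r =
  \sum_(v <- neighbors) expi (dotk k v) * f (red (emb r + v)) + (Q (emb r))%:C * f r.
Proof.
rewrite /kernel_app /bloch_kernel; under eq_bigr do rewrite mulrDl mulr_suml.
rewrite big_split /= exchange_big /=; congr (_ + _).
  apply: eq_bigr => v _; rewrite (bigD1 (red (emb r + v))) //= eqxx mul1r.
  rewrite big1 ?addr0 // => c /negPf; rewrite eq_sym => ->.
  by rewrite !mul0r.
rewrite (bigD1 r) //= eqxx mulr1 big1 ?addr0 // => c /negPf.
by rewrite eq_sym => ->; rewrite mulr0 mul0r.
Qed.

Definition bloch_wave k (f : cell -> C) : V -> C := fun u => expi (dotk k u) * f (red u).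

Lemma schrodinger_bloch k Q f u : tri_periodic p1 p2 Q ->
  schrodinger Q (bloch_wave k f) u =
  expi (dotk k u) * kernel_app (bloch_kernel k Q) f (red u).
Proof.
move=> Qp; rewrite schrodingerE kernel_app_bloch mulrDr; congr (_ + _).
  rewrite mulr_sumr; apply: eq_bigr => v _.
  by rewrite /bloch_wave dotkD expiD red_embD mulrA.
by rewrite (periodic_red Qp) /bloch_wave; ring.
Qed.

End Cell.
End Lattice.

(** * Bands belong to the spectrum *)

Section SquareSums.
Variable R : realType.
Local Notation C := R[i].
Local Notation V := (int * int)%type.
Implicit Types (psi phi : V -> C) (s t : seq V).

Definition sqsum psi s : R := \sum_(u <- s) sqmod (psi u).

Lemma sqsum_ge0 psi s : 0 <= sqsum psi s.
Proof. by apply: sumr_ge0 => u _; exact: sqmod_ge0. Qed.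

Lemma sqsum_le psi s t : uniq s -> uniq t ->
  (forall u, u \in s -> u \notin t -> psi u = 0) -> sqsum psi s <= sqsum psi t.
Proof.
move=> us ut h; rewrite /sqsum (bigID (mem t)) /= [X in _ + X]big1_seq ?addr0; last first.
  by move=> u /andP[uNt us']; rewrite h // sqmod0.
rewrite -big_filter (perm_big [seq u <- t | u \in s]).
  rewrite big_filter [leRHS](bigID (mem s)) /= lerDl.
  by apply: sumr_ge0 => u _; exact: sqmod_ge0.
by apply: uniq_perm; rewrite ?filter_uniq // => u; rewrite !mem_filter andbC.
Qed.

Lemma sqsum_sub psi s t : uniq s -> uniq t -> {subset s <= t} -> sqsum psi s <= sqsum psi t.
Proof. by move=> us ut st; apply: sqsum_le => // u /st ->. Qed.

Lemma sqsum_shift psi s v : sqsum (fun u => psi (u + v)) s = sqsum psi [seq u + v | u <- s].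
Proof. by rewrite /sqsum big_map. Qed.

Lemma uniq_shift s (v : V) : uniq s -> uniq [seq u + v | u <- s].
Proof. by move=> us; rewrite map_inj_uniq //; exact: addIr. Qed.

Lemma l2_sqnorm_ge psi s : uniq s -> ((sqsum psi s)%:E <= l2_sqnorm psi)%E.
Proof.
move=> us; apply: esum_ge; exists [set` s].
  by split => //; exact: finite_seq.
by rewrite -fsbig_seq // sumEFin.
Qed.

Lemma l2_sqnorm_le psi (K : R) : (forall s, uniq s -> sqsum psi s <= K) ->
  (l2_sqnorm psi <= K%:E)%E.
Proof.
move=> h; apply: ge_ereal_sup => _ [X [Xf _] <-].
rewrite fsbig_finite // sumEFin lee_fin.
exact: (h (finmap.enum_fset (fset_set X)) (finmap.fset_uniq (fset_set X))).
Qed.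

Lemma l2_sqnorm_fin psi : l2 psi -> exists2 r : R, 0 <= r & l2_sqnorm psi = r%:E.
Proof.
rewrite /l2 /=; have : (0 <= l2_sqnorm psi)%E.
  by apply: esum_ge0 => u _; rewrite lee_fin; exact: sqmod_ge0.
by case: (l2_sqnorm psi) => // r; rewrite lee_fin => r0 _; exists r.
Qed.

Lemma l2_bounded psi (K : R) : (forall s, uniq s -> sqsum psi s <= K) -> l2 psi.
Proof. by move=> /l2_sqnorm_le h; exact: le_lt_trans h (ltry _). Qed.

Definition box (L : nat) : seq V :=
  [seq (i%:Z - L%:Z, j%:Z - L%:Z) | i <- iota 0 (2 * L + 1), j <- iota 0 (2 * L + 1)].

Lemma mem_box L u : (u \in box L) = (- L%:Z <= u.1 <= L%:Z) && (- L%:Z <= u.2 <= L%:Z).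
Proof.
apply/allpairsP/idP => [[[i j] /= []]|].
  by rewrite !mem_iota => band_max hj -> /=; lia.
case: u => a b /= h; exists (`|(a + L%:Z)%R|%N, `|(b + L%:Z)%R|%N) => /=.
by rewrite !mem_iota; split; [lia|lia|congr pair; lia].
Qed.

Lemma box_uniq L : uniq (box L).
Proof.
apply: allpairs_uniq; rewrite ?iota_uniq // => [[i j] [k l]] _ _ /=.
by case=> /addIr [->] /addIr [->].
Qed.

Lemma size_box L : size (box L) = ((2 * L + 1) ^ 2)%N.
Proof. by rewrite size_allpairs size_iota expnS expn1. Qed.

Lemma box_sub L M : (L <= M)%N -> {subset box L <= box M}.
Proof. by move=> LM u; rewrite !mem_box; lia. Qed.

Definition star : seq V := 0 :: neighbors.

Lemma box_star L u v : v \in star -> u \in box L -> u + v \in box L.+1.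
Proof.
rewrite !mem_box /star /neighbors !inE /=.
by case: u v => a b [c d] /=; rewrite !xpair_eqE /=; lia.
Qed.

Lemma star_opp v : v \in star -> - v \in star.
Proof.
rewrite /star /neighbors !inE; case: v => c d.
have -> : - ((c, d) : V) = (- c, - d) by [].
by rewrite !xpair_eqE /=; lia.
Qed.

Lemma sqmod_sum (s : seq V) (F : V -> C) :
  sqmod (\sum_(v <- s) F v) <= 2 ^+ size s * \sum_(v <- s) sqmod (F v).
Proof.
elim: s => [|v s IH]; first by rewrite !big_nil sqmod0 mulr0.
rewrite !big_cons /= exprS mulrDr.
apply: le_trans (sqmodD_le _ _) _; apply: lerD.
  by rewrite ler_wpM2r ?sqmod_ge0 // ler_peMr // exprn_ege1 // ler1n.
by rewrite -mulrA ler_wpM2l.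
Qed.

Section Shifted.
Variables (Q : V -> R) (q : R) (z : C).
Hypothesis Qq : forall u, `|Q u| <= q.

Definition shifted psi : V -> C := fun u => schrodinger Q psi u - z * psi u.

Lemma shiftedE psi u :
  shifted psi u = \sum_(v <- neighbors) psi (u + v) + ((Q u)%:C - z) * psi u.
Proof. by rewrite /shifted schrodingerE mulrBl addrA. Qed.

Lemma shifted_eq psi phi u : (forall v, v \in star -> psi (u + v) = phi (u + v)) ->
  shifted psi u = shifted phi u.
Proof.
move=> h; rewrite !shiftedE; congr (_ + _ * _).
  by apply: eq_big_seq => v vs; apply: h; rewrite inE vs orbT.
by have := h 0; rewrite addr0; apply; rewrite inE eqxx.
Qed.

Definition shift_bound : R := 2 ^+ 7 * (1 + (2 * q ^+ 2 + 2 * sqmod z)).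

Lemma shift_bound_ge0 : 0 <= shift_bound.
Proof. rewrite /shift_bound mulr_ge0 ?exprn_ge0 //; have := sqr_ge0 q; have := sqmod_ge0 z;
    lra. Qed.

Lemma shifted_bound psi u : sqmod (shifted psi u) <= shift_bound * \sum_(v <- star) sqmod (psi
    (u + v)).
Proof.
have w0 : 0 <= 2 * q ^+ 2 + 2 * sqmod z.
  have := sqr_ge0 q; have := sqmod_ge0 z; lra.
pose F v := if v == 0 then ((Q u)%:C - z) * psi u else psi (u + v).
have -> : shifted psi u = \sum_(v <- star) F v.
  rewrite shiftedE [LHS]addrC /star [RHS]big_cons; congr (_ + _).
  apply: eq_big_seq => v vs; rewrite /F ifN //.
  by apply: contraTneq vs => ->.
apply: le_trans (sqmod_sum _ _) _; rewrite /shift_bound -[leRHS]mulrA ler_wpM2l ?exprn_ge0 //.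
rewrite mulr_sumr; apply: ler_sum => v _; rewrite /F.
case: eqP => [->|_]; last by rewrite ler_peMl ?sqmod_ge0 // lerDl.
rewrite addr0 sqmodM ler_wpM2r ?sqmod_ge0 //.
apply: le_trans (sqmodD_le _ _) _; rewrite sqmodN sqmod_real.
have : (Q u) ^+ 2 <= q ^+ 2 by rewrite -real_normK ?num_real // lerXn2r ?nnegrE // (le_trans _
    (Qq u)).
lra.
Qed.

Lemma shifted_sqsum psi s (K : R) :
  (forall v, v \in star -> sqsum (fun u => psi (u + v)) s <= K) ->
  sqsum (shifted psi) s <= shift_bound * (7 * K).
Proof.
move=> h; apply: (@le_trans _ _ (shift_bound * \sum_(v <- star) sqsum (fun u => psi (u + v))
    s)).
  rewrite /sqsum exchange_big /= mulr_sumr; apply: ler_sum => u _.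
  exact: shifted_bound.
rewrite ler_wpM2l ?shift_bound_ge0 //.
have -> : 7 * K = \sum_(v <- star) K by rewrite big_const_seq /= !addrA addr0; ring.
by rewrite big_seq [leRHS]big_seq; apply: ler_sum => v /h.
Qed.

Lemma shifted_l2 psi : l2 psi -> l2 (shifted psi).
Proof.
move=> /l2_sqnorm_fin[r r0 rE]; apply: (@l2_bounded _ (shift_bound * (7 * r))) => s us.
apply: shifted_sqsum => v _; rewrite sqsum_shift -lee_fin -rE.
exact: l2_sqnorm_ge (uniq_shift _ us).
Qed.

Definition supported psi L := forall u, u \notin box L -> psi u = 0.
Definition cutoff L psi : V -> C := fun u => if u \in box L then psi u else 0.

Lemma cutoff_supported L psi : supported (cutoff L psi) L.
Proof. by move=> u /negPf uL; rewrite /cutoff uL. Qed.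

Lemma shifted_supported psi L : supported psi L -> supported (shifted psi) L.+1.
Proof.
move=> h u uL; rewrite (@shifted_eq psi (fun=> 0)) ?shiftedE.
  by rewrite big1 // mulr0 addr0.
move=> v vn; apply: h; apply: contra uL => /(box_star (star_opp vn)).
by rewrite addrK.
Qed.

Lemma supported_sqsum psi L s : supported psi L -> uniq s -> sqsum psi s <= sqsum psi (box L).
Proof. by move=> h us; apply: sqsum_le; rewrite ?box_uniq // => u _; exact: h. Qed.

Lemma supported_l2 psi L : supported psi L -> l2 psi.
Proof. by move=> h; apply: (@l2_bounded _ (sqsum psi (box L))) => s; exact: supported_sqsum.
    Qed.

Lemma cutoff_sqsum L psi : sqsum (cutoff L psi) (box L) = sqsum psi (box L).
Proof. by apply: eq_big_seq => u uL; rewrite /cutoff uL. Qed.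

Definition coercive (A : R) := forall L psi, supported psi L ->
  sqsum psi (box L) <= A * sqsum (shifted psi) (box L.+1).

(* The cut-off of a solution at scale L fails to be a solution only on a shell,
   so coercivity bounds the mass of a box by the mass of its boundary shell:
   the masses of the boxes grow geometrically. *)
Lemma coercive_growth A eta L : 0 <= A -> coercive A -> (forall u, shifted eta u = 0) ->
  sqsum eta (box L.+2) <= A * (shift_bound * (7 * (sqsum eta (box L.+2) - sqsum eta (box L)))).
Proof.
move=> A0 coer Teta.
have := coer _ _ (@cutoff_supported L.+2 eta).
rewrite cutoff_sqsum => /le_trans; apply; rewrite ler_wpM2l //.
pose zeta u := cutoff L.+2 eta u - cutoff L eta u.
have zE : sqsum zeta (box L.+2) = sqsum eta (box L.+2) - sqsum eta (box L).
  have hL : sqsum eta (box L) = sqsum (cutoff L eta) (box L.+2).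
    apply/eqP; rewrite eq_le -(cutoff_sqsum L); apply/andP; split.
      by rewrite sqsum_sub ?box_uniq //; apply: box_sub; lia.
    by rewrite supported_sqsum ?box_uniq //; exact: cutoff_supported.
  rewrite hL /sqsum -sumrB; apply: eq_big_seq => u uL; rewrite /zeta /cutoff uL.
  by case: ifP => _; rewrite ?subrr ?subr0 ?sqmod0 ?subr0.
have zs : supported zeta L.+2.
  move=> u uL; rewrite /zeta /cutoff (negPf uL); case: ifP => [uL'|]; last by rewrite subr0.
  by move: uL; rewrite (@box_sub L) //; lia.
have hT u : sqmod (shifted (cutoff L.+2 eta) u) <= sqmod (shifted zeta u).
  have [uL|uL] := boolP (u \in box L.+1).
    rewrite (@shifted_eq _ eta) ?Teta ?sqmod0 ?sqmod_ge0 // => v vn.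
    by rewrite /cutoff (box_star vn uL).
  rewrite (@shifted_eq _ zeta) // => v vn.
  rewrite /zeta /cutoff; case: ifP => _; case: ifP => [uvL|_]; rewrite ?subr0 //.
    by move: uL; have := box_star (star_opp vn) uvL; rewrite addrK => ->.
  by move: uL; have := box_star (star_opp vn) uvL; rewrite addrK => ->.
apply: (@le_trans _ _ (sqsum (shifted zeta) (box L.+3))); first by apply: ler_sum => u _.
apply: shifted_sqsum => v _; rewrite sqsum_shift -zE.
by apply: supported_sqsum zs _; rewrite uniq_shift ?box_uniq.
Qed.

End Shifted.

Lemma exp_beats_quadratic (a h K : R) (L : nat) : 0 < h ->
  (forall m : nat, (1 + h) ^+ m * a <= K * (2 * (L + 2 * m)%:R + 1) ^+ 2) -> a <= 0.
Proof.
move=> h0 hm; rewrite leNgt; apply/negP => a0.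
have K0 : 0 <= K.
  have := hm 0%N; rewrite expr0 mul1r => /(lt_le_trans a0)/ltW.
  by rewrite pmulr_lge0 // exprn_gt0 // ltr_wpDl.
have bernoulli (m : nat) : m%:R * h <= (1 + h) ^+ m.
  elim: m => [|m IH]; first by rewrite mul0r.
  rewrite exprS -natr1 mulrDl mul1r [leRHS]mulrDl mul1r lerD //.
  by rewrite ler_peMr ?(ltW h0) // exprn_ege1 // lerDl ltW.
pose D : R := 17 + 2 * L%:R.
have key (n : nat) : n%:R ^+ 2 * (h ^+ 4 * a) <= K * D ^+ 2.
  case: n => [|n]; first by rewrite expr0n mul0r mulr_ge0 ?sqr_ge0.
  set x : R := n.+1%:R; have x1 : 1 <= x by rewrite ler1n.
  rewrite -(@ler_pM2l _ (x ^+ 2)) ?exprn_gt0 ?(lt_le_trans _ x1) //.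
  apply: (@le_trans _ _ ((1 + h) ^+ (n.+1 * 4) * a)).
    have -> : x ^+ 2 * (x ^+ 2 * (h ^+ 4 * a)) = (x * h) ^+ 4 * a by ring.
    rewrite ler_wpM2r ?(ltW a0) // exprM lerXn2r ?nnegrE //.
    - by rewrite mulr_ge0 // ltW // (lt_le_trans _ x1).
    - by rewrite exprn_ge0 // addr_ge0 // ltW.
    - exact: bernoulli.
  apply: le_trans (hm _) _.
  have -> : x ^+ 2 * (K * D ^+ 2) = K * (x * D) ^+ 2 by ring.
  have a1 : 0 <= 2 * (L + 2 * (n.+1 * 4))%:R + 1 :> R.
    by rewrite addr_ge0 // mulr_ge0.
  have a2 : 0 <= x * D by rewrite mulr_ge0 // /D addr_ge0 // mulr_ge0.
  rewrite ler_wpM2l // lerXn2r ?nnegrE //.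
  rewrite natrD natrM natrM -/x /D.
  have : 0 <= (x - 1) * L%:R by rewrite mulr_ge0 // subr_ge0.
  have : (L%:R : R) >= 0 by [].
  lra.
pose b := K * D ^+ 2 / (h ^+ 4 * a).
have ha0 : 0 < h ^+ 4 * a by rewrite mulr_gt0 // exprn_gt0.
have [n hn] : exists n : nat, b < n%:R.
  exists (Num.Def.truncn b).+1; exact: truncnS_gt.
have := key n.+1; rewrite -ler_pdivlMr // -/b => /le_lt_trans/(_ hn).
apply/negP; rewrite -leNgt -natrX ler_nat; nia.
Qed.

Lemma coercive_injective Q (q : R) z A eta (K : R) : (forall u, `|Q u| <= q) ->
  0 <= A -> coercive Q z A -> (forall u, shifted Q z eta u = 0) ->
  (forall L, sqsum eta (box L) <= K * (2 * L%:R + 1) ^+ 2) -> forall u, eta u = 0.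
Proof.
move=> Qq A0 coer Teta hK.
pose B := A * (shift_bound q z * 7) + 1.
have B0 : 0 < B by rewrite ltr_wpDl // mulr_ge0 // mulr_ge0 ?shift_bound_ge0.
have step L : (1 + B^-1) * sqsum eta (box L) <= sqsum eta (box L.+2).
  have := coercive_growth Qq L A0 coer Teta.
  set s2 := sqsum _ (box L.+2); set s0 := sqsum _ (box L) => h.
  have s02 : s0 <= s2 by rewrite sqsum_sub ?box_uniq //; apply: box_sub; lia.
  have h' : s2 <= B * (s2 - s0) by rewrite /B; move: h; lra.
  have : s0 / B <= s2 - s0 by rewrite ler_pdivrMr // mulrC (le_trans s02).
  by rewrite mulrDl mul1r mulrC; lra.
have grow L m : (1 + B^-1) ^+ m * sqsum eta (box L) <= sqsum eta (box (L + 2 * m)).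
  elim: m => [|m IH]; first by rewrite expr0 mul1r muln0 addn0.
  apply: le_trans (_ : _ <= (1 + B^-1) * sqsum eta (box (L + 2 * m))) _.
    by rewrite exprS -mulrA ler_wpM2l // addr_ge0 // invr_ge0 ltW.
  by have -> : (L + 2 * m.+1 = (L + 2 * m).+2)%N by lia.
have zero L : sqsum eta (box L) <= 0.
  apply: (@exp_beats_quadratic _ B^-1 K L); first by rewrite invr_gt0.
  by move=> m; apply: le_trans (grow L m) _; exact: hK.
move=> u; apply: sqmod_eq0; apply/eqP; rewrite eq_le sqmod_ge0 andbT.
apply: le_trans (zero (`|u.1| + `|u.2|)%N).
have uL : u \in box (`|u.1| + `|u.2|)%N.
  by rewrite mem_box; case: u => a b /=; lia.
rewrite /sqsum (bigD1_seq u) ?box_uniq //= lerDl.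
by apply: sumr_ge0 => v _; exact: sqmod_ge0.
Qed.

Lemma resolvent_coercive Q (q : R) z : (forall u, `|Q u| <= q) ->
  resolvent_set (schrodinger Q) z -> exists2 A, 0 <= A & coercive Q z A.
Proof.
move=> Qq [B [[_ [M hM]] hB]]; exists (M ^+ 2); first exact: sqr_ge0.
move=> L psi hs; have l2psi := supported_l2 hs.
have [BT _] := hB _ l2psi.
rewrite -lee_fin; apply: le_trans (l2_sqnorm_ge _ (box_uniq L)) _.
rewrite -{1}BT; apply: le_trans (hM _ (shifted_l2 _ Qq l2psi)) _.
rewrite [leRHS]EFinM lee_wpmul2l ?lee_fin ?sqr_ge0 //.
apply: l2_sqnorm_le => s us; apply: supported_sqsum us.
exact: shifted_supported.
Qed.

Section BlochSpectrum.
Variables (p1 p2 : nat) (hp1 : (0 < p1)%N) (hp2 : (0 < p2)%N).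

Lemma eigenval_spectrum Q (q : R) k n : (forall u, `|Q u| <= q) ->
  tri_periodic p1 p2 Q -> (n < #|{: cell p1 p2}|)%N ->
  spectrum (schrodinger Q) (eigenval (bloch_kernel hp1 hp2 k Q) n)%:C.
Proof.
move=> Qq Qp hn /(resolvent_coercive Qq)[A A0 coer].
set l := eigenval _ _ in coer.
have [f [[r fr] fE]] := eigenval_eigenvector (bloch_kernel_hermitian hp1 hp2 k Q) hn.
have T0 u : shifted Q l%:C (bloch_wave hp1 hp2 k f) u = 0.
  by rewrite /shifted schrodinger_bloch // fE /bloch_wave -/l mulrCA subrr.
have := coercive_injective Qq A0 coer T0 (K := sqnorm f).
move=> /(_ _ (emb r)) h.
have : bloch_wave hp1 hp2 k f (emb r) = 0.
  apply: h => L; apply: (@le_trans _ _ (\sum_(u <- box L) sqnorm f)).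
    apply: ler_sum => u _; rewrite /bloch_wave sqmodM sqmod_expi mul1r.
    rewrite /sqnorm (bigD1 (red hp1 hp2 u)) //= lerDl.
    by apply: sumr_ge0 => v _; exact: sqmod_ge0.
  rewrite big_const_seq count_predT iter_addr_0 size_box -[leLHS]mulr_natr natrX.
  by rewrite natrD natrM.
rewrite /bloch_wave redK => /eqP; rewrite mulf_eq0 (negPf (expi_neq0 _)) /=.
by rewrite (negPf fr).
Qed.

End BlochSpectrum.
End SquareSums.

(** * Inverting off the bands *)

Section Characters.
Variable R : realType.
Local Notation C := R[i].
Local Notation V := (int * int)%type.

Lemma expi_eq1 (x : R) : `|x| < 2 * pi -> expi x = 1 -> x = 0.
Proof.
move=> xpi ex; apply/eqP; rewrite -normr_eq0; apply/negPn/negP => x0.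
have : 0 < `|x| by rewrite lt_def x0 normr_ge0.
move=> x0'; have : 0 < sin (`|x| / 2) by apply: sin_gt0_pi; lra.
have : cos `|x| = 1 by rewrite cos_norm; case: ex.
have -> : cos `|x| = cos (`|x| / 2 *+ 2) by congr cos; rewrite -mulr_natr divfK.
rewrite cos_mulr2n cos2sin2; nra.
Qed.

Lemma expi_natM (x : R) (n : nat) : expi (x * n%:R) = expi x ^+ n.
Proof.
elim: n => [|n IH]; first by rewrite mulr0 expi0.
by rewrite -[n.+1%:R]natr1 mulrDr mulr1 expiD IH exprSr.
Qed.

Lemma sum_expi (N : nat) (a : int) : (0 < N)%N -> `|a| < N%:Z ->
  \sum_(m < N) expi (2 * pi * a%:~R / N%:R * m%:R : R) = (if a == 0 then N%:R else 0).
Proof.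
move=> N0 aN; have N0' : N%:R != 0 :> R by rewrite pnatr_eq0 -lt0n.
case: eqP => [->|/eqP a0].
  under eq_bigr do rewrite mulr0 !mul0r expi0.
  by rewrite sumr_const card_ord.
set th := 2 * pi * a%:~R / N%:R.
have e1 : expi th - 1 != 0.
  rewrite subr_eq0; apply: contra a0 => /eqP /expi_eq1 h.
  have pi0 := pi_gt0 R.
  have : th = 0.
    apply: h; rewrite /th normrM normfV normrM [`|2 * pi|]gtr0_norm; last by rewrite mulr_gt0.
    rewrite [`|N%:R|]ger0_norm // ltr_pdivrMr ?ltr0n // ltr_pM2l ?mulr_gt0 //.
    by rewrite -intr_norm -[N%:R]/(N%:Z%:~R) ltr_int.
  move/eqP; rewrite /th mulf_eq0 invr_eq0 (negPf N0') orbF mulf_eq0 mulf_eq0.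
  by rewrite pnatr_eq0 /= (gt_eqF pi0) /= intr_eq0.
apply: (mulfI e1); rewrite mulr0 -[RHS](subrr (1 : C)).
have -> : \sum_(m < N) expi (th * m%:R) = \sum_(m < N) expi th ^+ m.
  by apply: eq_bigr => m _; exact: expi_natM.
rewrite -subrX1 -expi_natM /th divfK //; congr (_ - _).
exact: expi_2pi.
Qed.

Lemma sum_cyclic (g : nat -> C) N : g N = g 0%N ->
  \sum_(a < N) g a.+1 = \sum_(a < N) g a.
Proof.
move=> gN; apply: (addrI (g 0%N)); rewrite -(big_ord_recl N (fun a : 'I_N.+1 => g a)).
by rewrite big_ord_recr /= gN addrC.
Qed.

(* [phi] is a Fourier component of [psi] along the translates by multiples of
   [w]; these components sum to a multiple of [psi], so one is nonzero. *)
Lemma bloch_reduce Q (l : C) (w : V) N (psi : V -> C) : (0 < N)%N ->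
  (forall u, Q (u + w) = Q u) -> (forall u, psi (u + w *+ N) = psi u) ->
  (exists u, psi u != 0) -> (forall u, schrodinger Q psi u = l * psi u) ->
  exists (m : nat) (phi : V -> C), [/\ exists u, phi u != 0,
    forall u, schrodinger Q phi u = l * phi u,
    forall u, phi (u + w) = expi (2 * pi * m%:R / N%:R) * phi u
  & forall w' c, (forall u, psi (u + w') = c * psi u) ->
      forall u, phi (u + w') = c * phi u].
Proof.
move=> N0 Qw psiN [u0 pu0] psiE; have N0' : N%:R != 0 :> R by rewrite pnatr_eq0 -lt0n.
pose phi (m : nat) u := \sum_(a < N) expi (- (2 * pi * a%:R / N%:R * m%:R)) * psi (u + w *+ a).
have Qwa a u : Q (u + w *+ a) = Q u.
  by elim: a u => [|a IH] u; rewrite ?mulr0n ?addr0 // mulrS addrA IH.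
have [m phim] : exists m : 'I_N, phi m u0 != 0.
  apply/not_existsP => h.
  have : \sum_(m < N) phi m u0 = 0.
    by apply: big1 => m _; apply/eqP/negPn/negP; exact: h.
  rewrite /phi exchange_big /=.
  under eq_bigr => a _.
    rewrite -mulr_suml.
    have -> : \sum_(i < N) expi (- (2 * pi * a%:R / N%:R * i%:R)) =
       \sum_(i < N) expi (2 * pi * (- (a : nat)%:Z)%:~R / N%:R * i%:R) :> C.
      by apply: eq_bigr => i _; congr expi; rewrite mulrNz; ring.
    rewrite sum_expi //; last by rewrite normrN ltz_nat ltn_ord.
    over.
  rewrite /= (bigD1 (Ordinal N0)) //= addr0 [X in _ + X]big1 ?addr0; last first.
    move=> a a0; rewrite oppr_eq0 (_ : (_ == 0) = false) ?mul0r //.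
    by apply: contra_neqF a0 => /eqP[a0]; apply: val_inj.
  move/eqP; rewrite mulf_eq0 (negPf pu0) orbF.
  by rewrite pnatr_eq0 eqn0Ngt N0.
exists m, (phi m); split.
- by exists u0.
- move=> u; rewrite schrodingerE /phi exchange_big /= !mulr_sumr -big_split /=.
  apply: eq_bigr => a _; rewrite [RHS]mulrCA -psiE schrodingerE Qwa [RHS]mulrDr.
  congr (_ + _); last by rewrite mulrCA.
  by rewrite -mulr_sumr; congr (_ * _); apply: eq_bigr => v _; rewrite addrAC.
- move=> u; pose g (a : nat) := expi (- (2 * pi * a%:R / N%:R * m%:R)) * psi (u + w *+ a).
  have gN : g N = g 0%N.
    rewrite /g psiN mulr0n addr0 mulr0 !mul0r oppr0 expi0 mul1r mulfK //.
    by rewrite expiN (expi_2pi _ m) rmorph1 mul1r.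
  rewrite /phi -(sum_cyclic gN) mulr_sumr; apply: eq_bigr => a _.
  rewrite /g mulrA -expiD [w *+ _.+1]mulrS [u + (w + _)]addrA; congr (expi _ * _).
  by rewrite -[a.+1%:R]natr1; field.
- move=> w' c h u; rewrite /phi mulr_sumr; apply: eq_bigr => a _.
  by rewrite addrAC h mulrCA.
Qed.

Lemma pairMn1 (p a : nat) : ((p%:Z, 0) : V) *+ a = ((a * p)%N%:Z, 0).
Proof. by elim: a => [//|a IH]; rewrite mulrS IH /=; congr pair; rewrite ?addr0; lia. Qed.

Lemma pairMn2 (p a : nat) : ((0, p%:Z) : V) *+ a = (0, (a * p)%N%:Z).
Proof. by elim: a => [//|a IH]; rewrite mulrS IH /=; congr pair; rewrite ?addr0; lia. Qed.

Lemma add_pair1 (u : V) x : u + (x, 0) = (u.1 + x, u.2).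
Proof. by case: u => a b /=; rewrite -[LHS]/(a + x, b + 0) addr0. Qed.

Lemma add_pair2 (u : V) x : u + (0, x) = (u.1, u.2 + x).
Proof. by case: u => a b /=; rewrite -[LHS]/(a + 0, b + x) addr0. Qed.

Section Torus.
Variables (p1 p2 : nat) (hp1 : (0 < p1)%N) (hp2 : (0 < p2)%N).
Variables (Q : V -> R).
Hypothesis Qp : tri_periodic p1 p2 Q.
Local Notation K k := (bloch_kernel hp1 hp2 k Q).

Lemma bloch_solution_eigenval (k : R * R) (l : R) (psi : V -> C) :
  (exists u, psi u != 0) -> (forall u, schrodinger Q psi u = l%:C * psi u) ->
  (forall u, psi (u + (p1%:Z, 0)) = expi (k.1 * p1%:R) * psi u) ->
  (forall u, psi (u + (0, p2%:Z)) = expi (k.2 * p2%:R) * psi u) ->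
  exists2 n, (n < #|{: cell p1 p2}|)%N & eigenval (K k) n = l.
Proof.
move=> [u0 pu0] psiE psi1 psi2.
pose g u := expi (- dotk k u) * psi u.
have d1 : dotk k (p1%:Z, 0) = k.1 * p1%:R by rewrite /dotk mulr0 addr0.
have d2 : dotk k (0, p2%:Z) = k.2 * p2%:R by rewrite /dotk mulr0 add0r.
have gp u : g (u.1 + p1%:Z, u.2) = g u /\ g (u.1, u.2 + p2%:Z) = g u.
  rewrite -add_pair1 -add_pair2 /g psi1 psi2 !dotkD d1 d2.
  move: (dotk k u) => x; rewrite !opprD !expiD; split.
    by rewrite -mulrA; congr (_ * _); rewrite mulrA expiNK mul1r.
  by rewrite -mulrA; congr (_ * _); rewrite mulrA expiNK mul1r.
have gred := periodic_red hp1 hp2 gp.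
pose f (r : cell p1 p2) := g (emb r).
have psiB : psi = bloch_wave hp1 hp2 k f.
  apply/funext => u; rewrite /bloch_wave /f gred /g mulrA [expi _ * expi _]mulrC expiNK.
  by rewrite mul1r.
apply: (@eigenvalue_eigenval _ _ (K k) f); first exact: bloch_kernel_hermitian.
  exists (red hp1 hp2 u0); apply: contra pu0 => /eqP f0.
  by rewrite psiB /bloch_wave f0 mulr0.
move=> r; have := psiE (emb r); rewrite {1}psiB schrodinger_bloch // redK psiB /bloch_wave redK.
by rewrite mulrCA => /(mulfI (expi_neq0 _)).
Qed.

Section Cover.
Variable N : nat.
Hypothesis N0 : (0 < N)%N.
Let hn1 : (0 < N * p1)%N. Proof. by rewrite muln_gt0 N0. Qed.
Let hn2 : (0 < N * p2)%N. Proof. by rewrite muln_gt0 N0. Qed.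
Local Notation tred := (red hn1 hn2).
Local Notation tK := (bloch_kernel hn1 hn2 (0, 0) Q).

Lemma cover_periodic : tri_periodic (N * p1) (N * p2) Q.
Proof.
case=> a b; rewrite /= !PoszM; split.
  apply: (@periodicz _ (fun x => Q (x, b))) => x.
  by have [] := Qp (x, b).
apply: (@periodicz _ (fun x => Q (a, x))) => x.
by have [] := Qp (a, x).
Qed.

Lemma bloch_wave0 (f : cell (N * p1) (N * p2) -> C) u : bloch_wave hn1 hn2 (0, 0) f u = f (tred
    u).
Proof. by rewrite /bloch_wave dot0k expi0 mul1r. Qed.

Lemma cover_eigenval d e : diagonalizes tK d e -> forall i,
  exists k n, (n < #|{: cell p1 p2}|)%N /\ eigenval (K k) n = d i.
Proof.
move=> [eort _ eig] i.
pose psi := bloch_wave hn1 hn2 (0, 0) (e i).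
have psiE u : schrodinger Q psi u = (d i)%:C * psi u.
  rewrite /psi schrodinger_bloch; last exact: cover_periodic.
  by rewrite eig /bloch_wave mulrCA.
have psi0 : exists u, psi u != 0.
  apply/not_existsP => h; have := eort i i; rewrite eqxx /inner big1 => [/eqP|t _].
    by rewrite eq_sym oner_eq0.
  have := h (emb t); rewrite /psi bloch_wave0 redK => /negP/negPn/eqP ->.
  by rewrite mul0r.
have per1 u : psi (u + (p1%:Z, 0) *+ N) = psi u.
  rewrite pairMn1 /psi !bloch_wave0; congr (e i _).
  by apply/redP; rewrite add_pair1 /=; split => //; rewrite modzDr.
have per2 u : psi (u + (0, p2%:Z) *+ N) = 1 * psi u.
  rewrite mul1r pairMn2 /psi !bloch_wave0; congr (e i _).
  by apply/redP; rewrite add_pair2 /=; split => //; rewrite modzDr.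
have Q1 u : Q (u + (p1%:Z, 0)) = Q u by rewrite add_pair1; have [] := Qp u.
have Q2 u : Q (u + (0, p2%:Z)) = Q u by rewrite add_pair2; have [] := Qp u.
have [m1 [phi [phi0 phiE phi1 phiT]]] := bloch_reduce N0 Q1 per1 psi0 psiE.
have per2' u : phi (u + (0, p2%:Z) *+ N) = phi u by rewrite (phiT _ _ per2) mul1r.
have [m2 [chi [chi0 chiE chi2 chiT]]] := bloch_reduce N0 Q2 per2' phi0 phiE.
pose k : R * R := (2 * pi * m1%:R / N%:R / p1%:R, 2 * pi * m2%:R / N%:R / p2%:R).
exists k; have [| |n hn hl] := @bloch_solution_eigenval k (d i) _ chi0 chiE.
- move=> u; rewrite (chiT _ _ phi1) /k /= divfK //.
  by rewrite pnatr_eq0 -lt0n.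
- move=> u; rewrite chi2 /k /= divfK //.
  by rewrite pnatr_eq0 -lt0n.
- by exists n.
Qed.

(* The representative of [x] modulo [n] in [[-m, n - m)]. *)
Definition rep1 (n m : nat) (x : int) : int := ((x + m%:Z) %% n%:Z)%Z - m%:Z.

Lemma rep1_id n m x : - m%:Z <= x < n%:Z - m%:Z -> rep1 n m x = x.
Proof. by move=> h; rewrite /rep1 modz_small ?addrK //; lia. Qed.

Lemma rep1_range n m x : (0 < n)%N -> - m%:Z <= rep1 n m x < n%:Z - m%:Z.
Proof.
move=> n0; have h1 : 0 <= ((x + m%:Z) %% n%:Z)%Z by apply: modz_ge0; lia.
by have h2 : ((x + m%:Z) %% n%:Z)%Z < n%:Z by [apply: ltz_pmod]; rewrite /rep1; lia.
Qed.

Lemma rep1_mod (n m : nat) x : (rep1 n m x = x %[mod n])%Z.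
Proof. by rewrite /rep1 -modzDml modz_mod modzDml addrK. Qed.

Lemma rep1_eqmod (n m : nat) x y : (x = y %[mod n])%Z -> rep1 n m x = rep1 n m y.
Proof. by move=> h; rewrite /rep1 -modzDml h modzDml. Qed.

Lemma rep1_near n m (L : nat) x : (2 * L + 5 <= n)%N -> m = L.+2 ->
  - m%:Z - 1 <= x <= n%:Z - m%:Z ->
  rep1 n m x = x \/
  (~~ (- L%:Z <= x <= L%:Z) /\ ~~ (- L%:Z <= rep1 n m x <= L%:Z)).
Proof.
move=> nL mL hx.
have [h|] := boolP (- m%:Z <= x < n%:Z - m%:Z); first by left; exact: rep1_id.
move=> h; right.
have : x = - m%:Z - 1 \/ x = n%:Z - m%:Z by lia.
case=> ->; split; try lia.
  rewrite (@rep1_eqmod _ _ _ (n%:Z - m%:Z - 1)); last first.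
    by rewrite -[in LHS](modzDr _ n); congr (_ %% _)%Z; lia.
  by rewrite rep1_id; lia.
rewrite (@rep1_eqmod _ _ _ (- m%:Z)); last first.
  by rewrite -[in RHS](modzDr _ n); congr (_ %% _)%Z; lia.
by rewrite rep1_id; lia.
Qed.

Definition rep (m : nat) (u : V) : V := (rep1 (N * p1) m u.1, rep1 (N * p2) m u.2).
Definition window (m : nat) : seq V := [seq rep m (emb r) | r <- enum {: cell (N * p1) (N *
    p2)}].

Lemma red_rep m u : tred (rep m u) = tred u.
Proof. by apply/redP; split; exact: rep1_mod. Qed.

Lemma rep_red m u v : tred u = tred v -> rep m u = rep m v.
Proof. by move/redP=> [h1 h2]; congr pair; exact: rep1_eqmod. Qed.

Lemma window_uniq m : uniq (window m).
Proof.
rewrite map_inj_uniq ?enum_uniq // => r s /(congr1 tred).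
by rewrite !red_rep !redK.
Qed.

Lemma window_sum m (F : V -> C) : sqsum F (window m) = sqnorm (fun r : cell (N * p1) (N * p2)
    => F (rep m (emb r))).
Proof. by rewrite /sqsum /sqnorm big_map big_enum. Qed.

Lemma box_window m L : (L <= m)%N -> (L + m < N * p1)%N -> (L + m < N * p2)%N ->
  forall u, u \in box L -> rep m u = u /\ u \in window m.
Proof.
move=> Lm h1 h2 u; rewrite mem_box => hu.
have ru : rep m u = u.
  by case: u hu => a b /= hu; rewrite /rep /= !rep1_id //; lia.
split => //; apply/mapP; exists (tred u); rewrite ?mem_enum // -{1}ru.
by apply: rep_red; rewrite redK.
Qed.

Section Coercive.
Variables (z : C) (delta : R).
Hypothesis delta0 : 0 < delta.
Hypothesis gap : forall k n, (n < #|{: cell p1 p2}|)%N -> delta <= sqmod ((eigenval (K k) n)%:C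
    - z).

Lemma cover_coercive f :
  delta * sqnorm f <= sqnorm (fun r => kernel_app tK f r - z * f r).
Proof.
have [d [e D]] := spectral_kernel (bloch_kernel_hermitian hn1 hn2 (0, 0) Q).
apply: (shifted_sqnorm_ge D) => i; have [k [n [hn <-]]] := cover_eigenval D i; exact: gap.
Qed.

Lemma cover_solve g : exists f, forall r, kernel_app tK f r - z * f r = g r.
Proof.
have [d [e D]] := spectral_kernel (bloch_kernel_hermitian hn1 hn2 (0, 0) Q).
apply: (shifted_solve D _ delta0) => i; have [k [n [hn <-]]] := cover_eigenval D i; exact: gap.
Qed.

Lemma shifted_cover f u :
  shifted Q z (bloch_wave hn1 hn2 (0, 0) f) u = kernel_app tK f (tred u) - z * f (tred u).
Proof.
rewrite /shifted schrodinger_bloch; last exact: cover_periodic.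
by rewrite bloch_wave0 dot0k expi0 mul1r.
Qed.

Lemma cover_box_coercive L psi : (2 * L + 5 <= N)%N -> supported psi L ->
  sqsum psi (box L) <= delta^-1 * sqsum (shifted Q z psi) (box L.+1).
Proof.
move=> NL hs; set m := L.+2.
have hN1 : (N <= N * p1)%N by rewrite leq_pmulr.
have hN2 : (N <= N * p2)%N by rewrite leq_pmulr.
pose f (r : cell (N * p1) (N * p2)) := psi (rep m (emb r)).
have fE u : f (tred u) = psi (rep m u).
  by rewrite /f; congr psi; apply: rep_red; rewrite redK.
rewrite mulrC ler_pdivlMr // mulrC.
apply: (@le_trans _ _ (delta * sqnorm f)).
  rewrite ler_pM2l // -window_sum sqsum_sub ?box_uniq ?window_uniq // => u uL.
  by have [|||_ //] := @box_window m L _ _ _ u uL; rewrite /m; lia.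
apply: le_trans (cover_coercive f) _.
have -> : sqnorm (fun r => kernel_app tK f r - z * f r) = sqsum (shifted Q z psi) (window m).
  rewrite window_sum; apply: eq_bigr => r _; congr sqmod.
  rewrite -[r in LHS](redK hn1 hn2) -(red_rep m) -shifted_cover.
  apply: shifted_eq => v vn; rewrite bloch_wave0 fE.
  have h1 : - m%:Z <= (rep m (emb r)).1 < (N * p1)%:Z - m%:Z by exact: rep1_range.
  have h2 : - m%:Z <= (rep m (emb r)).2 < (N * p2)%:Z - m%:Z by exact: rep1_range.
  have [v1 v2] : -1 <= v.1 <= 1 /\ -1 <= v.2 <= 1.
    move: vn; rewrite /star /neighbors !inE; case: v => c d; rewrite !xpair_eqE /=.
    by lia.
  move: (rep m (emb r)) h1 h2 => t h1 h2.
  set w := t + v.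
  have w1 : - m%:Z - 1 <= w.1 <= (N * p1)%:Z - m%:Z by rewrite -[w.1]/(t.1 + v.1); lia.
  have w2 : - m%:Z - 1 <= w.2 <= (N * p2)%:Z - m%:Z by rewrite -[w.2]/(t.2 + v.2); lia.
  have n1L : (2 * L + 5 <= N * p1)%N by lia.
  have n2L : (2 * L + 5 <= N * p2)%N by lia.
  have [e1 | [far1 far1b]] := rep1_near n1L (erefl m) w1.
    have [e2 | [far2 far2b]] := rep1_near n2L (erefl m) w2.
      by rewrite /rep e1 e2; case: w {w1 w2 e1 e2}.
    by rewrite !hs // mem_box /= negb_and ?far2 ?far2b orbT.
  by rewrite !hs // mem_box /= negb_and ?far1 ?far1b.
apply: sqsum_le; rewrite ?window_uniq ?box_uniq // => u _.
exact: shifted_supported.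
Qed.

Lemma cover_solution m phi (r0 : R) : (2 * m < N)%N ->
  (forall s, uniq s -> sqsum phi s <= r0) ->
  exists psi : V -> C, [/\ forall u, u \in box m -> shifted Q z psi u = phi u,
    forall u, sqmod (psi u) <= delta^-1 * r0
  & forall s, uniq s -> {subset s <= box m} -> sqsum psi s <= delta^-1 * r0].
Proof.
move=> mN hphi.
have hN1 : (N <= N * p1)%N by rewrite leq_pmulr.
have hN2 : (N <= N * p2)%N by rewrite leq_pmulr.
have [f fE] := cover_solve (fun r => phi (rep m (emb r))).
have fn : sqnorm f <= delta^-1 * r0.
  rewrite mulrC ler_pdivlMr // mulrC; apply: le_trans (cover_coercive f) _.
  have -> : sqnorm (fun r => kernel_app tK f r - z * f r) = sqsum phi (window m).
    by rewrite window_sum; apply: eq_bigr => r _; rewrite fE.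
  by apply: hphi; exact: window_uniq.
exists (bloch_wave hn1 hn2 (0, 0) f); split.
- move=> u um; have [|||ru _] := @box_window m m _ _ _ u um; try lia.
  rewrite shifted_cover fE -{2}ru; congr phi; apply: rep_red.
  by rewrite redK.
- move=> u; rewrite bloch_wave0; apply: le_trans fn.
  rewrite /sqnorm (bigD1 (tred u)) //= lerDl.
  by apply: sumr_ge0 => r _; exact: sqmod_ge0.
- move=> s us sm; apply: le_trans fn.
  have -> : sqnorm f = sqsum (bloch_wave hn1 hn2 (0, 0) f) (window m).
    rewrite window_sum; apply: eq_bigr => r _.
    by rewrite bloch_wave0 red_rep redK.
  apply: sqsum_sub; rewrite ?window_uniq // => u /sm um.
  by have [|||_ //] := @box_window m m _ _ _ u um; lia.
Qed.

End Coercive.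
End Cover.
End Torus.
End Characters.

Section Resolvent.
Variable R : realType.
Local Notation C := R[i].
Local Notation V := (int * int)%type.

Section UltraLimit.
Variables (U : set_system nat).
Context {UU : UltraFilter U}.

Lemma ultra_cvg (x : nat -> R) (M : R) : (forall n, `|x n| <= M) ->
  exists l : R, x @ U --> l.
Proof.
move=> xM; have UF : ProperFilter U by exact: ultra_proper.
have FA : U (x @^-1` `[- M, M]%classic).
  apply: filterE => n /=; rewrite in_itv /=; have := xM n.
  by rewrite ler_norml.
have [l [_ lcl]] := @segment_compact R (- M) M (x @ U) _ FA.
exists l => B Bl; have [//|UnB] := in_ultra_setVsetC (x @^-1` B) UU.
have [y [nBy By]] := lcl (~` B) B UnB Bl.
by case: nBy.
Qed.

Definition cplx_cvg (w : nat -> C) (l : C) :=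
  (fun n => complex.Re (w n)) @ U --> complex.Re l /\
  (fun n => complex.Im (w n)) @ U --> complex.Im l.

Lemma cplx_cvg_bounded (w : nat -> C) (M : R) : (forall n, sqmod (w n) <= M) ->
  exists l, cplx_cvg w l.
Proof.
move=> wM; have bnd (x : R) : x ^+ 2 <= M -> `|x| <= M + 1.
  by move=> h; rewrite ler_norml; apply/andP; split; nra.
have [a ha] : exists a : R, (fun n => complex.Re (w n)) @ U --> a.
  apply: (@ultra_cvg _ (M + 1)) => n; apply/bnd/(le_trans _ (wM n)).
  by rewrite lerDl sqr_ge0.
have [b hb] : exists b : R, (fun n => complex.Im (w n)) @ U --> b.
  apply: (@ultra_cvg _ (M + 1)) => n; apply/bnd/(le_trans _ (wM n)).
  by rewrite lerDr sqr_ge0.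
by exists (a +i* b)%C.
Qed.

Lemma cplx_cvgD w1 w2 l1 l2 : cplx_cvg w1 l1 -> cplx_cvg w2 l2 -> cplx_cvg (fun n => w1 n + w2
    n) (l1 + l2).
Proof.
have UF : ProperFilter U by exact: ultra_proper.
move=> [r1 i1] [r2 i2]; split; rewrite raddfD /=.
  under eq_fun do rewrite raddfD /=.
  exact: cvgD r1 r2.
under eq_fun do rewrite raddfD /=.
exact: cvgD i1 i2.
Qed.

Lemma cplx_cvgM c w l : cplx_cvg w l -> cplx_cvg (fun n => c * w n) (c * l).
Proof.
have UF : ProperFilter U by exact: ultra_proper.
have ReM (z : C) : complex.Re (c * z) = complex.Re c * complex.Re z - complex.Im c * complex.Im
    z.
  by case: c z => a b [d e].
have ImM (z : C) : complex.Im (c * z) = complex.Re c * complex.Im z + complex.Im c * complex.Re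
    z.
  by case: c z {ReM} => a b [d e].
move=> [r i]; split; rewrite ?ReM ?ImM.
  under eq_fun do rewrite ReM.
  by apply: cvgB; apply: cvgM; rewrite //; exact: cvg_cst.
under eq_fun do rewrite ImM.
by apply: cvgD; apply: cvgM; rewrite //; exact: cvg_cst.
Qed.

Lemma cplx_cvg_sum (s : seq V) (w : V -> nat -> C) (l : V -> C) :
  (forall v, cplx_cvg (w v) (l v)) -> cplx_cvg (fun n => \sum_(v <- s) w v n) (\sum_(v <- s) l
      v).
Proof.
have UF : ProperFilter U by exact: ultra_proper.
move=> h; elim: s => [|v s IH].
  rewrite big_nil; under eq_fun do rewrite big_nil.
  by split; exact: cvg_cst.
rewrite big_cons; under eq_fun do rewrite big_cons.
exact: cplx_cvgD.
Qed.

Lemma cplx_cvg_const w l c : cplx_cvg w l -> (\forall n \near U, w n = c) -> l = c.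
Proof.
have UF : ProperFilter U by exact: ultra_proper.
move=> [r i] h; case: l r i => a b /= r i; case: c h => c d h.
congr (_ +i* _)%C.
  apply: (@cvg_unique _ (@norm_hausdorff _ _) _ _ _ _ r); apply: cvg_near_cst.
  by apply: filterS h => n ->.
apply: (@cvg_unique _ (@norm_hausdorff _ _) _ _ _ _ i); apply: cvg_near_cst.
by apply: filterS h => n ->.
Qed.

Lemma sqmod_cvg w l : cplx_cvg w l -> (fun n => sqmod (w n)) @ U --> sqmod l.
Proof.
have UF : ProperFilter U by exact: ultra_proper.
by move=> [r i]; rewrite /sqmod; apply: cvgD; rewrite !expr2; apply: cvgM.
Qed.

Lemma sqsum_cvg (s : seq V) (w : nat -> V -> C) (l : V -> C) :
  (forall v, cplx_cvg (fun n => w n v) (l v)) -> (fun n => sqsum (w n) s) @ U --> sqsum l s.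
Proof.
have UF : ProperFilter U by exact: ultra_proper.
move=> h; rewrite /sqsum; elim: s => [|v s IH].
  rewrite big_nil; under eq_fun do rewrite big_nil.
  exact: cvg_cst.
rewrite big_cons; under eq_fun do rewrite big_cons.
by apply: cvgD IH; exact: sqmod_cvg.
Qed.

End UltraLimit.

Variables (p1 p2 : nat) (hp1 : (0 < p1)%N) (hp2 : (0 < p2)%N).
Variables (Q : V -> R) (q : R).
Hypothesis Qp : tri_periodic p1 p2 Q.
Hypothesis Qq : forall u, `|Q u| <= q.
Local Notation K k := (bloch_kernel hp1 hp2 k Q).
Variables (z : C) (delta : R).
Hypothesis delta0 : 0 < delta.
Hypothesis gap : forall k n, (n < #|{: cell p1 p2}|)%N -> delta <= sqmod ((eigenval (K k) n)%:C
    - z).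

Lemma shifted_surjective phi (r0 : R) : (forall s, uniq s -> sqsum phi s <= r0) ->
  exists psi : V -> C, (forall u, shifted Q z psi u = phi u) /\
    (forall s, uniq s -> sqsum psi s <= delta^-1 * r0).
Proof.
move=> hphi.
have ex (m : nat) : exists psi : V -> C, [/\ forall u, u \in box m -> shifted Q z psi u = phi u,
    forall u, sqmod (psi u) <= delta^-1 * r0
  & forall s, uniq s -> {subset s <= box m} -> sqsum psi s <= delta^-1 * r0].
  have mN : (2 * m < (2 * m).+1)%N by [].
  exact: (cover_solution Qp (ltn0Sn (2 * m)) delta0 gap mN hphi).
have [w hw] := choice ex.
have [U [UU Uoo]] := @ultraFilterLemma nat \oo _.
have UF : ProperFilter U by exact: ultra_proper.
have ev m0 (P : nat -> Prop) : (forall m, (m0 <= m)%N -> P m) -> \forall m \near U, P m.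
  by move=> h; apply: Uoo; exists m0.
have lims u : exists l, cplx_cvg U (fun m => w m u) l.
  by apply: (@cplx_cvg_bounded U UU _ (delta^-1 * r0)) => m; have [_ ] := hw m.
have [psi hpsi] := choice lims.
exists psi; split.
- move=> u; apply: (@cplx_cvg_const U UU (fun m => shifted Q z (w m) u)).
    rewrite shiftedE; under eq_fun do rewrite shiftedE.
    by apply: cplx_cvgD; [apply: cplx_cvg_sum => v|apply: cplx_cvgM].
  apply: (@ev (`|u.1| + `|u.2|)%N) => m hm; have [h _ _] := hw m.
  by apply: h; rewrite mem_box; case: u hm => a b /=; lia.
- move=> s us; apply: cvgr_to_le (@sqsum_cvg U UU s w psi hpsi) _.
  apply: (@ev (\sum_(u <- s) (`|u.1| + `|u.2|))%N) => m hm; have [_ _ h] := hw m.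
  apply: h => // u us'; rewrite mem_box.
  have : (`|u.1| + `|u.2| <= m)%N.
    by apply: leq_trans hm; rewrite (big_rem u) //= leq_addr.
  by case: u {us'} => a b /=; lia.
Qed.

Lemma shifted_coercive : coercive Q z delta^-1.
Proof.
move=> L psi hs.
have N0 : (0 < 2 * L + 5)%N by rewrite addnS.
exact: (cover_box_coercive Qp N0 delta0 gap (leqnn _) hs).
Qed.

Lemma shifted_injective (eta : V -> C) (r : R) : (forall s, uniq s -> sqsum eta s <= r) ->
  (forall u, shifted Q z eta u = 0) -> forall u, eta u = 0.
Proof.
move=> hr T0; apply: (coercive_injective Qq _ shifted_coercive T0 (K := r)).
  by rewrite invr_ge0 ltW.
move=> L; apply: le_trans (hr _ (box_uniq L)) _.
have r0 : 0 <= r by apply: le_trans (hr [::] _); rewrite // sqsum_ge0.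
have L0 : 0 <= 2 * L%:R :> R by rewrite mulr_ge0.
by rewrite ler_peMr // exprn_ege1 // lerDr.
Qed.

Lemma shiftedD (a : C) (phi psi : V -> C) u :
  shifted Q z (fun v => a * phi v + psi v) u = a * shifted Q z phi u + shifted Q z psi u.
Proof.
rewrite !shiftedE big_split /= -mulr_sumr; ring.
Qed.

Lemma gap_resolvent : resolvent_set (schrodinger Q) z.
Proof.
pose good (phi psi : V -> C) := (forall u, shifted Q z psi u = phi u) /\
  (l2_sqnorm psi <= (delta^-1)%:E * l2_sqnorm phi)%E.
pose B (phi : V -> C) := xget (fun=> 0) [set psi | good phi psi].
have Bgood phi : l2 phi -> good phi (B phi).
  move=> l2phi; apply: xgetPex; have [r r0 rE] := l2_sqnorm_fin l2phi.
  have [|psi [h1 h2]] := @shifted_surjective phi r.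
    by move=> s us; rewrite -lee_fin -rE; exact: l2_sqnorm_ge.
  by exists psi; split => //; rewrite rE -EFinM; exact: l2_sqnorm_le.
have l2B phi : l2 phi -> l2 (B phi).
  move=> l2phi; have [r r0 rE] := l2_sqnorm_fin l2phi.
  by have [_] := Bgood _ l2phi; rewrite rE -EFinM => /le_lt_trans; apply; exact: ltry.
have uniqB (psi1 psi2 : V -> C) : l2 psi1 -> l2 psi2 ->
    (forall u, shifted Q z psi1 u = shifted Q z psi2 u) -> psi1 = psi2.
  move=> /l2_sqnorm_fin[r1 _ E1] /l2_sqnorm_fin[r2 _ E2] h; apply/funext => u.
  apply/eqP; rewrite -subr_eq0 addrC -mulN1r; apply/eqP.
  apply: (@shifted_injective (fun u => -1 * psi2 u + psi1 u) (2 * r2 + 2 * r1)).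
    move=> s us; apply: (@le_trans _ _ (2 * sqsum psi2 s + 2 * sqsum psi1 s)).
      rewrite /sqsum !mulr_sumr -big_split /=; apply: ler_sum => v _.
      by apply: le_trans (sqmodD_le _ _) _; rewrite mulN1r sqmodN.
    by rewrite lerD // ler_pM2l // -lee_fin -?E1 -?E2 l2_sqnorm_ge.
  by move=> v; rewrite shiftedD h mulN1r addNr.
exists B; split; first split.
- move=> a phi psi l2phi l2psi.
  have l2lin (a' : C) (f g : V -> C) : l2 f -> l2 g -> l2 (fun u => a' * f u + g u).
    move=> /l2_sqnorm_fin[r1 _ E1] /l2_sqnorm_fin[r2 _ E2].
    apply: (@l2_bounded _ _ (2 * sqmod a' * r1 + 2 * r2)) => s us.
    apply: (@le_trans _ _ (2 * sqmod a' * sqsum f s + 2 * sqsum g s)).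
      rewrite /sqsum !mulr_sumr -big_split /=; apply: ler_sum => v _.
      by apply: le_trans (sqmodD_le _ _) _; rewrite sqmodM mulrA.
    apply: lerD; rewrite ler_wpM2l ?mulr_ge0 ?sqmod_ge0 //.
      by rewrite -lee_fin -E1 l2_sqnorm_ge.
    by rewrite -lee_fin -E2 l2_sqnorm_ge.
  apply: uniqB; [exact/l2B/l2lin|by apply: l2lin; exact: l2B|].
  move=> u; have [-> _] := Bgood _ (l2lin a _ _ l2phi l2psi).
  by rewrite shiftedD; have [-> _] := Bgood _ l2phi; have [-> _] := Bgood _ l2psi.
- have d0 : 0 <= delta^-1 by rewrite invr_ge0 ltW.
  exists (Num.sqrt delta^-1) => psi l2psi; have [_ h] := Bgood _ l2psi.
  by rewrite sqr_sqrtr.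
- move=> psi l2psi; have l2T := shifted_l2 z Qq l2psi.
  split; last by apply/funext => u; have [h _] := Bgood _ l2psi; exact: h.
  apply: uniqB => //; first exact: l2B.
  by move=> u; have [h _] := Bgood _ l2T; exact: h.
Qed.

End Resolvent.

(** * Bands *)

Section Bands.
Variable R : realType.
Local Notation C := R[i].
Local Notation V := (int * int)%type.

Lemma common_positive (P : nat) (A : nat -> R -> Prop) :
  (forall n d d', 0 < d' <= d -> A n d -> A n d') ->
  (forall n, (n < P)%N -> exists2 d, 0 < d & A n d) ->
  exists2 d, 0 < d & forall n, (n < P)%N -> A n d.
Proof.
move=> mono; elim: P => [|P IH] h; first by exists 1.
have [|d d0 hd] := IH; first by move=> n nP; apply: h; exact: ltnW.
have [d' d0' hd'] := h P (ltnSn P).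
have m0 : 0 < Num.min d d' by rewrite lt_min d0.
exists (Num.min d d') => // n; rewrite ltnS leq_eqVlt => /orP[/eqP ->|nP].
  by apply: (mono _ d') hd'; rewrite m0 ge_min lexx orbT.
by apply: (mono _ d) (hd _ nP); rewrite m0 ge_min lexx.
Qed.

Variables (p1 p2 : nat) (hp1 : (0 < p1)%N) (hp2 : (0 < p2)%N).
Implicit Types (Q : V -> R) (k : R * R).
Local Notation P := #|{: cell p1 p2}|.

Definition band Q k n : R := eigenval (bloch_kernel hp1 hp2 k Q) n.

Lemma band_mono Q k n m : (n <= m < P)%N -> band Q k n <= band Q k m.
Proof. exact: eigenval_mono. Qed.

Lemma band_perturb Q Q' (c : R) k n : (n < P)%N -> (forall u, `|Q' u - Q u| <= c) ->
  `|band Q' k n - band Q k n| <= c.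
Proof.
move=> nP hc; apply: eigenval_close; rewrite //; try exact: bloch_kernel_hermitian.
move=> f; have -> : complex.Re (inner (kernel_app (bloch_kernel hp1 hp2 k Q') f) f) -
     complex.Re (inner (kernel_app (bloch_kernel hp1 hp2 k Q) f) f) =
     \sum_r (Q' (emb r) - Q (emb r)) * sqmod (f r).
  rewrite -raddfB /inner -sumrB raddf_sum; apply: eq_bigr => r _.
  rewrite !kernel_app_bloch -mulrBl opprD addrACA subrr add0r -mulrBl -rmorphB /=.
  by rewrite -mulrA -sqmodE -rmorphM.
apply: le_trans (ler_norm_sum _ _ _) _; rewrite mulr_sumr; apply: ler_sum => r _.
by rewrite normrM [`|sqmod _|]ger0_norm ?sqmod_ge0 // ler_wpM2r ?sqmod_ge0.
Qed.

Definition kdist (k k' : R * R) : R := \sum_(v <- neighbors) sqmod (expi (dotk k' v) - expi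
    (dotk k v)).

Lemma kdist_ge0 k k' : 0 <= kdist k k'.
Proof. by apply: sumr_ge0 => v _; exact: sqmod_ge0. Qed.

Lemma band_kdist Q k k' n : (n < P)%N ->
  `|band Q k' n - band Q k n| <= P%:R * Num.sqrt (2 ^+ 6 * kdist k k').
Proof.
move=> nP; have h0 : 0 <= 2 ^+ 6 * kdist k k' by rewrite mulr_ge0 ?exprn_ge0 ?kdist_ge0.
apply: eigenval_entrywise; rewrite ?sqrtr_ge0 //; try exact: bloch_kernel_hermitian.
move=> r s; rewrite sqr_sqrtr // /bloch_kernel.
have -> : \sum_(v <- neighbors) (red hp1 hp2 (emb r + v) == s)%:R * expi (dotk k' v) +
    (Q (emb r))%:C * (r == s)%:R -
   (\sum_(v <- neighbors) (red hp1 hp2 (emb r + v) == s)%:R * expi (dotk k v) +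
    (Q (emb r))%:C * (r == s)%:R) =
   \sum_(v <- neighbors) (red hp1 hp2 (emb r + v) == s)%:R * (expi (dotk k' v) - expi (dotk k
       v)).
  rewrite opprD addrACA subrr addr0 -sumrB; apply: eq_bigr => v _; ring.
apply: le_trans (sqmod_sum _ _) _; rewrite /= ler_wpM2l ?exprn_ge0 //.
apply: ler_sum => v _; rewrite sqmodM; case: eqP => _.
  by rewrite (sqmod_real 1) expr1n mul1r.
by rewrite (sqmod_real 0) expr0n mul0r sqmod_ge0.
Qed.

Lemma kdist_cvg k : kdist k k' @[k' --> k] --> (0 : R).
Proof.
have cd v : dotk k' v @[k' --> k] --> dotk k v.
  rewrite /dotk; apply: cvgD; apply: cvgM; try exact: cvg_cst.
    exact: cvg_fst.
  exact: cvg_snd.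
have cn v : sqmod (expi (dotk k' v) - expi (dotk k v)) @[k' --> k] --> (0 : R).
  have -> : 0 = sqmod (expi (dotk k v) - expi (dotk k v)) :> R by rewrite subrr sqmod0.
  rewrite /sqmod /expi /=; apply: cvgD; rewrite !expr2; apply: cvgM; apply: cvgB; try exact:
      cvg_cst.
  - by apply: continuous_cvg (cd v); exact: continuous_cos.
  - by apply: continuous_cvg (cd v); exact: continuous_cos.
  - by apply: continuous_cvg (cd v); exact: continuous_sin.
  - by apply: continuous_cvg (cd v); exact: continuous_sin.
have cs (s : seq V) : (fun k' => \sum_(v <- s) sqmod (expi (dotk k' v) - expi (dotk k v))) @
    nbhs k --> (0 : R).
  elim: s => [|v s IH].
    by rewrite (_ : (fun _ => _) = cst 0); [exact: cvg_cst|apply/funext => k'; rewrite big_nil].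
  rewrite (_ : (fun _ => _) = (fun k' => sqmod (expi (dotk k' v) - expi (dotk k v))) +
    (fun k' => \sum_(v <- s) sqmod (expi (dotk k' v) - expi (dotk k v)))); last first.
    by apply/funext => k'; rewrite big_cons.
  by have := cvgD (cn v) IH; rewrite addr0; apply.
exact: cs.
Qed.

Lemma band_continuous Q n : (n < P)%N -> continuous (fun k => band Q k n).
Proof.
move=> nP k.
have cG : (P%:R * Num.sqrt (2 ^+ 6 * kdist k k') : R) @[k' --> k] --> (0 : R).
  rewrite -[X in _ --> X](mulr0 (P%:R : R)); apply: cvgM; first exact: cvg_cst.
  rewrite -[X in _ --> X](sqrtr0 R); apply: continuous_cvg; first exact: sqrt_continuous.
  rewrite -[X in _ --> X](mulr0 (2 ^+ 6 : R)); apply: cvgM; first exact: cvg_cst.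
  exact: kdist_cvg.
apply/cvgrPdist_lt => e e0; move/cvgrPdist_lt: cG => /(_ _ e0); apply: filterS => k'.
rewrite sub0r normrN => h; rewrite distrC; apply: le_lt_trans (band_kdist _ _ _ nP) _.
exact: le_lt_trans (ler_norm _) h.
Qed.

Lemma band_periodic Q k (m1 m2 : int) n :
  band Q (k.1 + 2 * pi * m1%:~R, k.2 + 2 * pi * m2%:~R) n = band Q k n.
Proof.
rewrite /band; congr eigenval; apply/funext => r; apply/funext => c; rewrite /bloch_kernel.
congr (_ + _); apply: eq_bigr => v _; congr (_ * _).
have -> : dotk (k.1 + 2 * pi * m1%:~R, k.2 + 2 * pi * m2%:~R) v =
   dotk k v + 2 * pi * (m1 * v.1 + m2 * v.2)%:~R.
  by rewrite /dotk /= rmorphD !rmorphM /=; ring.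
by rewrite expiD expi_2pi mulr1.
Qed.

Lemma reduce_angle (x : R) : exists m : int, 0 <= x + 2 * pi * m%:~R <= 2 * pi.
Proof.
have pi0 : 0 < 2 * pi :> R by rewrite mulr_gt0 // pi_gt0.
exists (- Num.floor (x / (2 * pi))); rewrite mulrNz mulrN.
have := floor_le_tmp (x / (2 * pi)); have := floorD1_gt (x / (2 * pi)).
rewrite ltr_pdivrMr // ler_pdivlMr // rmorphD /= mulrDl mul1r; lra.
Qed.

Lemma band_extrema Q n : (n < P)%N ->
  exists ka kb, forall k, band Q ka n <= band Q k n <= band Q kb n.
Proof.
move=> nP; pose A := (`[0, 2 * pi] `*` `[0, 2 * pi])%classic : set (R * R).
have cA : compact A by apply: compact_setX; exact: segment_compact.
have A0 : A !=set0.
  exists (0, 0); split => /=; rewrite in_itv /= lexx /= mulr_ge0 // pi_ge0 //.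
have cf : {within A, continuous (fun k => band Q k n)}.
  by apply: continuous_subspaceT; exact: band_continuous.
have [ka _ hka] := compact_EVT_min A0 cA cf.
have [kb _ hkb] := compact_EVT_max A0 cA cf.
exists ka, kb => k.
have [m1 h1] := reduce_angle k.1; have [m2 h2] := reduce_angle k.2.
rewrite -(band_periodic Q k m1 m2).
have kA : (k.1 + 2 * pi * m1%:~R, k.2 + 2 * pi * m2%:~R) \in A.
  by rewrite inE; split => /=; rewrite in_itv.
by rewrite hka // hkb.
Qed.

(* The default value 0 of [xget] is only taken when [n] is out of range. *)
Definition band_min Q n : R := xget 0 [set x | (exists k, x = band Q k n) /\ forall k, x <=
    band Q k n].
Definition band_max Q n : R := xget 0 [set x | (exists k, x = band Q k n) /\ forall k, band Q k
    n <= x].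

Lemma band_minP Q n : (n < P)%N -> (exists k, band_min Q n = band Q k n) /\ forall k, band_min
    Q n <= band Q k n.
Proof.
move=> nP; have [ka [kb h]] := band_extrema Q nP.
apply: (@xgetPex _ 0 [set x | (exists k, x = band Q k n) /\ forall k, x <= band Q k n]).
by exists (band Q ka n); split; [exists ka|move=> k; have /andP[] := h k].
Qed.

Lemma band_maxP Q n : (n < P)%N -> (exists k, band_max Q n = band Q k n) /\ forall k, band Q k
    n <= band_max Q n.
Proof.
move=> nP; have [ka [kb h]] := band_extrema Q nP.
apply: (@xgetPex _ 0 [set x | (exists k, x = band Q k n) /\ forall k, band Q k n <= x]).
by exists (band Q kb n); split; [exists kb|move=> k; have /andP[] := h k].
Qed.

Lemma band_min_le_max Q n : (n < P)%N -> band_min Q n <= band_max Q n.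
Proof.
by move=> nP; have [_ /(_ (0, 0))/le_trans] := band_minP Q nP; apply; have [_] := band_maxP Q
    nP.
Qed.

Lemma band_min_mono Q n m : (n <= m < P)%N -> band_min Q n <= band_min Q m.
Proof.
move=> /[dup] nm /andP[nm' mP]; have [[k ->] _] := band_minP Q mP.
by apply: le_trans (band_mono _ _ nm); have [_] := band_minP Q (leq_ltn_trans nm' mP).
Qed.

Lemma band_max_mono Q n m : (n <= m < P)%N -> band_max Q n <= band_max Q m.
Proof.
move=> /[dup] nm /andP[nm' mP]; have [[k ->] _] := band_maxP Q (leq_ltn_trans nm' mP).
by apply: le_trans (band_mono _ _ nm) _; have [_] := band_maxP Q mP.
Qed.

Lemma band_min_perturb Q Q' (c : R) n : (n < P)%N -> (forall u, `|Q' u - Q u| <= c) ->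
  band_min Q' n <= band_min Q n + c.
Proof.
move=> nP hc; have [[k ->] _] := band_minP Q nP; have [_ /(_ k) h] := band_minP Q' nP.
by apply: le_trans h _; have := band_perturb k nP hc; rewrite ler_norml; lra.
Qed.

Lemma band_max_perturb Q Q' (c : R) n : (n < P)%N -> (forall u, `|Q' u - Q u| <= c) ->
  band_max Q n - c <= band_max Q' n.
Proof.
move=> nP hc; have [[k ->] _] := band_maxP Q nP; have [_ /(_ k)] := band_maxP Q' nP.
by apply: le_trans; have := band_perturb k nP hc; rewrite ler_norml; lra.
Qed.

Lemma band_ivt Q n x : (n < P)%N -> band_min Q n <= x <= band_max Q n -> exists k, band Q k n =
    x.
Proof.
move=> nP; have [[ka ->] _] := band_minP Q nP; have [[kb ->] _] := band_maxP Q nP => hx.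
pose g (t : R) : R * R := (ka.1 + t * (kb.1 - ka.1), ka.2 + t * (kb.2 - ka.2)).
have g0 : g 0 = ka by rewrite /g !mul0r !addr0; case: (ka).
have g1 : g 1 = kb by rewrite [RHS]surjective_pairing /g; congr pair; ring.
have cg : continuous g.
  have ca (a b : R) : continuous (fun t : R => a + t * (b - a)).
    by move=> t; apply: cvgD; [exact: cvg_cst|apply: cvgM; [exact: cvg_id|exact: cvg_cst]].
  by move=> t; exact: (cvg_pair (ca ka.1 kb.1 t) (ca ka.2 kb.2 t)).
have cc : continuous ((fun k => band Q k n) \o g).
  move=> t; apply: continuous_comp; first exact: cg.
  exact: band_continuous.
have cf : {within `[0, 1], continuous ((fun k => band Q k n) \o g)}.
  exact: continuous_subspaceT cc.
have [|t _ <-] := IVT (v := x) ler01 cf; last by exists (g t).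
by rewrite /= g0 g1; case/andP: hx => h1 h2; rewrite ge_min h1 /= le_max h2 orbT.
Qed.

Lemma spectrumE Q (q : R) w : (forall u, `|Q u| <= q) -> tri_periodic p1 p2 Q ->
  spectrum (schrodinger Q) w <->
  exists x n, [/\ w = x%:C, (n < P)%N & band_min Q n <= x <= band_max Q n].
Proof.
move=> Qq Qp; split; last first.
  move=> [x [n [-> nP /(band_ivt nP)[k <-]]]]; exact: eigenval_spectrum Qq Qp nP.
move=> spec; apply: contrapT => nex; apply: spec.
have [| |delta delta0 gap] := @common_positive P (fun n d => forall k, d <= sqmod ((band Q k
    n)%:C - w)).
- by move=> n d d' /andP[_ dd'] h k; apply: le_trans dd' (h k).
- move=> n nP; case: w nex => x y nex.
  have n2E' k : sqmod ((band Q k n)%:C - (x +i* y)%C) = (band Q k n - x) ^+ 2 + y ^+ 2.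
    by rewrite /sqmod /= sub0r sqrrN.
  have [y0|y0] := eqVneq y 0; last first.
    exists (y ^+ 2); first by rewrite exprn_even_gt0.
    by move=> k; rewrite n2E' lerDr sqr_ge0.
  have [_ hlo] := band_minP Q nP; have [_ hhi] := band_maxP Q nP.
  have [xlo|xlo] := ltP x (band_min Q n).
    exists ((band_min Q n - x) ^+ 2); first by rewrite exprn_gt0 // subr_gt0.
    move=> k; rewrite n2E' y0 expr0n addr0; have := hlo k; nra.
  have [xhi|xhi] := ltP (band_max Q n) x.
    exists ((x - band_max Q n) ^+ 2); first by rewrite exprn_gt0 // subr_gt0.
    move=> k; rewrite n2E' y0 expr0n addr0; have := hhi k; nra.
  by case: nex; exists x, n; rewrite y0 xlo xhi.
apply: (gap_resolvent Qp Qq delta0) => k n nP; exact: gap.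
Qed.

End Bands.

(** * The free operator *)

Section PlaneWaves.
Variable R : realType.
Local Notation C := R[i].
Local Notation V := (int * int)%type.

Definition dispersion (k : R * R) : R := 2 * cos k.1 + 2 * cos k.2 + 2 * cos (k.1 - k.2).

Lemma dispersionE k : \sum_(v <- neighbors) expi (dotk k v) = (dispersion k)%:C.
Proof.
rewrite /neighbors !big_cons big_nil addr0 /dispersion /dotk /=.
have e (x : R) : expi x + expi (- x) = (2 * cos x)%:C.
  by rewrite /expi cosN sinN; simpc; congr (_ +i* _)%C; ring.
have -> : k.1 * 1%:~R + k.2 * 0%:~R = k.1 by ring.
have -> : k.1 * (-1)%:~R + k.2 * 0%:~R = - k.1 by ring.
have -> : k.1 * 0%:~R + k.2 * 1%:~R = k.2 by ring.
have -> : k.1 * 0%:~R + k.2 * (-1)%:~R = - k.2 by ring.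
have -> : k.1 * 1%:~R + k.2 * (-1)%:~R = k.1 - k.2 by ring.
have -> : k.1 * (-1)%:~R + k.2 * 1%:~R = - (k.1 - k.2) by ring.
by rewrite !rmorphD /= -!e; ring.
Qed.

Variables (p1 p2 : nat) (hp1 : (0 < p1)%N) (hp2 : (0 < p2)%N).
Local Notation cell := (cell p1 p2).

Definition offset (j : cell) : R * R :=
  (2 * pi * j.1%:R / p1%:R, 2 * pi * j.2%:R / p2%:R).

Definition free_value (k : R * R) (j : cell) : R :=
  dispersion (k.1 + (offset j).1, k.2 + (offset j).2).

Let p1neq0 : p1%:R != 0 :> R. Proof. by rewrite pnatr_eq0 -lt0n. Qed.
Let p2neq0 : p2%:R != 0 :> R. Proof. by rewrite pnatr_eq0 -lt0n. Qed.

Lemma sum_characters (a1 a2 : int) : `|a1| < p1%:Z -> `|a2| < p2%:Z ->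
  \sum_(r : cell) expi (2 * pi * a1%:~R / p1%:R * r.1%:R + 2 * pi * a2%:~R / p2%:R * r.2%:R :
      R) =
  ((a1 == 0) && (a2 == 0))%:R * (p1 * p2)%:R.
Proof.
move=> h1 h2.
under eq_bigr do rewrite expiD.
rewrite -(pair_bigA _ (fun (x : 'I_p1) (y : 'I_p2) =>
  expi (2 * pi * a1%:~R / p1%:R * x%:R) * expi (2 * pi * a2%:~R / p2%:R * y%:R : R))) /=.
under eq_bigr do rewrite -mulr_sumr.
rewrite -mulr_suml !sum_expi // natrM.
by case: eqP => _; case: eqP => _; rewrite ?mul0r ?mulr0 ?mul1r.
Qed.

Definition wave (j : cell) (u : V) : C := expi (dotk (offset j) u).

Lemma wave_red j u : wave j (emb (red hp1 hp2 u)) = wave j u.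
Proof.
apply: (periodic_red hp1 hp2) => {}u.
have d1 : dotk (offset j) (p1%:Z, 0) = 2 * pi * (j.1 : nat)%:Z%:~R.
  by rewrite /dotk mulr0 addr0 /= -[X in _ * X]/(p1%:R) divfK.
have d2 : dotk (offset j) (0, p2%:Z) = 2 * pi * (j.2 : nat)%:Z%:~R.
  by rewrite /dotk mulr0 add0r /= -[X in _ * X]/(p2%:R) divfK.
rewrite -add_pair1 -add_pair2 /wave !dotkD d1 d2; move: (dotk _ _) => x.
by rewrite !expiD !expi_2pi mulr1.
Qed.

Let s : R := (Num.sqrt (p1 * p2)%:R)^-1.

Let s2 : s%:C * s%:C * (p1 * p2)%:R = 1.
Proof.
have h : 0 < (p1 * p2)%:R :> R by rewrite ltr0n muln_gt0 hp1.
rewrite -rmorphM -expr2 /s exprVn sqr_sqrtr ?(ltW h) //.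
by rewrite -[X in _ * X](rmorph_nat (real_complex R)) -rmorphM /= mulVf ?gt_eqF // rmorph1.
Qed.

Lemma plane_waves k :
  diagonalizes (bloch_kernel hp1 hp2 k (fun=> 0)) (free_value k) (fun j r => s%:C * wave j (emb
      r)).
Proof.
have sconj : (s%:C : C)^* = s%:C by rewrite conjE conjc_real.
have dist n (a b : 'I_n) : `|(a : nat)%:Z - (b : nat)%:Z| < n%:Z.
  by have := ltn_ord a; have := ltn_ord b; lia.
have sub0 n (a b : 'I_n) : ((a : nat)%:Z - (b : nat)%:Z == 0) = (a == b).
  by rewrite subr_eq0 eqz_nat.
have key (i j : cell) : \sum_(r : cell) (s%:C * wave i (emb r)) * (s%:C * wave j (emb r))^* =
    (i == j)%:R.
  transitivity (s%:C * s%:C * \sum_(r : cell)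
     expi (2 * pi * ((i.1 : nat)%:Z - (j.1 : nat)%:Z)%:~R / p1%:R * r.1%:R +
          2 * pi * ((i.2 : nat)%:Z - (j.2 : nat)%:Z)%:~R / p2%:R * r.2%:R : R)).
    rewrite mulr_sumr; apply: eq_bigr => r _.
    rewrite rmorphM /= sconj /wave -expiN mulrACA -expiD; congr (_ * expi _).
    by rewrite /dotk /offset /= !rmorphB /=; ring.
  rewrite sum_characters // !sub0 mulrCA s2 mulr1.
  by case: i j => i1 i2 [j1 j2]; rewrite xpair_eqE.
split.
- by move=> i j; rewrite /inner key.
- move=> r t; rewrite -key; apply: eq_bigr => i _.
  have sym (x y : cell) : wave x (emb y) = wave y (emb x).
    by rewrite /wave /dotk /offset /=; congr expi; ring.
  by rewrite (sym i r) (sym i t).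
- move=> j r; rewrite kernel_app_bloch mul0r addr0 /free_value.
  rewrite -[X in (dispersion X)%:C]/((k.1 + (offset j).1, k.2 + (offset j).2)) -dispersionE
      mulr_suml.
  apply: eq_bigr => v _; rewrite wave_red /wave dotkD expiD.
  have -> : dotk (k.1 + (offset j).1, k.2 + (offset j).2) v = dotk k v + dotk (offset j) v.
    by rewrite /dotk /=; ring.
  rewrite expiD; ring.
Qed.

Lemma band_free k n : (n < #|{: cell}|)%N -> band hp1 hp2 (fun=> 0) k n = sorted_value
    (free_value k) n.
Proof. by move=> nP; exact: eigenval_diag nP (plane_waves k). Qed.

Lemma free_count_lt k n E : (n < #|{: cell}|)%N ->
  E <= band hp1 hp2 (fun=> 0) k n -> (num_lt (free_value k) E <= n)%N.
Proof. by move=> nP; rewrite band_free // leNgt sorted_value_lt // -leqNgt. Qed.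

Lemma free_count_le k n E : (n < #|{: cell}|)%N ->
  band hp1 hp2 (fun=> 0) k n <= E -> (n < num_le (free_value k) E)%N.
Proof. by move=> nP; rewrite band_free // sorted_value_le. Qed.

End PlaneWaves.

Section Dispersion.
Variable R : realType.

Lemma poly_nonroot (G : {poly R}) (a b : R) : a < b -> G != 0 ->
  exists2 x, a < x < b & G.[x] != 0.
Proof.
move=> ab G0; pose x (i : nat) : R := a + (b - a) / i.+2%:R.
have ba : b - a != 0 by rewrite gt_eqF // subr_gt0.
have x_inj : injective x.
  move=> i j /addrI /(mulfI ba) /invr_inj /eqP.
  by rewrite eqr_nat => /eqP [].
have : ~~ all (root G) [seq x i | i <- iota 0 (size G)].
  apply/negP => allr.
  have := max_poly_roots G0 allr.
  by rewrite map_inj_uniq // iota_uniq size_map size_iota ltnn => /(_ isT).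
rewrite -has_predC => /hasP[_ /mapP[i _ ->]] /= ri; exists (x i) => //.
have i2 : 0 < i.+2%:R :> R by rewrite ltr0n.
rewrite /x ltrDl divr_gt0 ?subr_gt0 //= -ltrBrDl ltr_pdivrMr //.
by rewrite ltr_pMr ?subr_gt0 // ltr1n.
Qed.

Lemma cos_double (x : R) : cos (2 * x) = 2 * cos x ^+ 2 - 1.
Proof. by rewrite [2 * x]mulr_natl cos_mulr2n -[_ *+ 2]mulr_natl. Qed.

Lemma sin_double (x : R) : sin (2 * x) = 2 * (cos x * sin x).
Proof. by rewrite [2 * x]mulr_natl sin_mulr2n -[_ *+ 2]mulr_natl. Qed.

Lemma half_angle (t : R) : cos (2 * atan t) = (1 - t ^+ 2) / (1 + t ^+ 2) /\
  sin (2 * atan t) = 2 * t / (1 + t ^+ 2).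
Proof.
have q0 : 1 + t ^+ 2 != 0 by rewrite gt_eqF // ltr_wpDr ?sqr_ge0.
have c2 : cos (atan t) ^+ 2 = (1 + t ^+ 2)^-1.
  by rewrite cos_atan exprVn sqr_sqrtr // addr_ge0 ?sqr_ge0.
have c0 : cos (atan t) != 0.
  apply/eqP => c0; move: c2; rewrite c0 expr0n => /esym/eqP.
  by rewrite invr_eq0 (negPf q0).
have st : sin (atan t) = t * cos (atan t).
  by rewrite -{2}(atanK t) /tan divfK.
rewrite cos_double sin_double st c2; split; first by field.
have -> : cos (atan t) * (t * cos (atan t)) = t * cos (atan t) ^+ 2 by ring.
by rewrite c2; field.
Qed.

Lemma generic_sin (cs : seq R) : exists x, forall c, c \in cs -> sin (x + c) != 0.
Proof.
pose F (c : R) : {poly R} := (sin c)%:P * (1 - 'X^2) + (2 * cos c)%:P * 'X.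
have F0 c : F c != 0.
  apply/eqP => F0; have h0 : (F c).[0] = 0 by rewrite F0 horner0.
  have h1 : (F c).[1] = 0 by rewrite F0 horner0.
  move: h0 h1; rewrite /F !hornerE /=.
  have := cos2Dsin2 c; nra.
have G0 : \prod_(c <- cs) F c != 0.
  by rewrite prodf_seq_neq0; apply/allP => c _; rewrite F0.
have [t _ ht] := poly_nonroot ltr01 G0.
exists (2 * atan t) => c ccs; have [ct st] := half_angle t.
have q0 : 1 + t ^+ 2 != 0 by rewrite gt_eqF // ltr_wpDr ?sqr_ge0.
move: ht; rewrite horner_prod prodf_seq_neq0 => /allP/(_ c ccs) /=.
apply: contra => /eqP; rewrite sinD ct st => h.
have -> : (F c).[t] = (1 + t ^+ 2) * (2 * t / (1 + t ^+ 2) * cos c + (1 - t ^+ 2) / (1 + t ^+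
    2) * sin c).
  by rewrite /F !hornerE /=; field.
by rewrite h mulr0.
Qed.

Lemma dispersion_xy (x y : R) : dispersion (x + y, x - y) = 4 * cos x * cos y + 4 * cos y ^+ 2
    - 2.
Proof.
rewrite /dispersion /=; have -> : x + y - (x - y) = 2 * y by ring.
rewrite cosD cosB cos_double; ring.
Qed.

Lemma dispersion_factor (k : R * R) :
  dispersion k + 2 = 8 * cos (k.1 / 2) * (cos (k.2 / 2) * cos (k.1 / 2 - k.2 / 2)).
Proof.
rewrite /dispersion; case: k => k1 k2 /=; set a := k1 / 2; set b := k2 / 2.
have -> : k1 - k2 = 2 * (a - b) by rewrite /a /b; field.
have -> : k1 = 2 * a by rewrite /a; field.
have -> : k2 = 2 * b by rewrite /b; field.
rewrite !cos_double cosB.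
have := sin2cos2 a; have := sin2cos2 b.
move: (sin a) (cos a) (sin b) (cos b) => sa ca sb cb hb ha.
have -> : (ca * cb + sa * sb) ^+ 2 = ca ^+ 2 * cb ^+ 2 + 2 * ca * cb * sa * sb + sa ^+ 2 * sb
    ^+ 2 by ring.
rewrite ha hb; ring.
Qed.

(* Eliminating x between [cos x * D = e - D^2] and
   [cos (x + a) * D' = e - D'^2], where [D = cos y] and [D' = cos (y + b)],
   leaves this polynomial in [t = tan (y / 2)]. *)
Definition elim_poly (e ca sa cb sb : R) : {poly R} :=
  let q := 1 + 'X^2 in let D := 1 - 'X^2 in
  let D' := cb%:P * (1 - 'X^2) - sb%:P * (2 * 'X) in
  (e%:P * q ^+ 2 - D ^+ 2) ^+ 2 * D' ^+ 2 + (e%:P * q ^+ 2 - D' ^+ 2) ^+ 2 * D ^+ 2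
  - 2 * ca%:P * (e%:P * q ^+ 2 - D ^+ 2) * (e%:P * q ^+ 2 - D' ^+ 2) * D * D'
  - sa%:P ^+ 2 * q ^+ 2 * D ^+ 2 * D' ^+ 2.

Lemma horner_neq0 (G : {poly R}) x : G.[x] != 0 -> G != 0.
Proof. by apply: contraNneq => ->; rewrite horner0. Qed.

Lemma elim_poly_neq0 e ca sa cb sb : e != 0 -> ca ^+ 2 + sa ^+ 2 = 1 -> cb ^+ 2 + sb ^+ 2 = 1 ->
  ~ (sb = 0 /\ ca = cb) -> elim_poly e ca sa cb sb != 0.
Proof.
move=> e0 hca hcb nontriv; have [sb0|sb0] := eqVneq sb 0; last first.
  apply: (@horner_neq0 _ 1); rewrite /elim_poly !hornerE /=.
  rewrite [X in X != 0](_ : _ = (8 * e * sb) ^+ 2); last by ring.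
  by rewrite expf_neq0 // !mulf_neq0.
have cb2 : cb ^+ 2 = 1 by rewrite -hcb sb0 expr0n addr0.
have cb2P : cb%:P ^+ 2 = 1 :> {poly R} by rewrite -rmorphXn /= cb2.
set D : {poly R} := 1 - 'X^2; set q : {poly R} := 1 + 'X^2.
pose W : {poly R} := (e%:P * q ^+ 2 - D ^+ 2) ^+ 2 * (2 - 2 * ca%:P * cb%:P) - sa%:P ^+ 2 * q
    ^+ 2 * D ^+ 2.
have -> : elim_poly e ca sa cb sb = D ^+ 2 * W.
  rewrite /elim_poly /= sb0 -/D -/q mul0r subr0 !exprMn cb2P !mul1r /W.
  by ring.
rewrite mulf_neq0 //.
  rewrite expf_neq0 //; apply: (@horner_neq0 _ 0); rewrite /D !hornerE /=.
  by rewrite expr0n subr0 oner_eq0.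
apply: (@horner_neq0 _ 1); rewrite /W /D /q !hornerE /=.
rewrite [X in X != 0](_ : _ = 32 * e ^+ 2 * (1 - ca * cb)); last by ring.
rewrite !mulf_neq0 ?expf_neq0 // subr_eq0; apply/eqP => h; apply: nontriv; split => //.
by rewrite -[ca]mulr1 -cb2 expr2 mulrA -h mul1r.
Qed.

Lemma elim_poly_root e ca sa cb sb (t C Sx : R) : ca ^+ 2 + sa ^+ 2 = 1 ->
  let D := (1 - t ^+ 2) / (1 + t ^+ 2) in let S := 2 * t / (1 + t ^+ 2) in
  let D' := D * cb - S * sb in let C' := C * ca - Sx * sa in
  C ^+ 2 + Sx ^+ 2 = 1 -> C * D = e - D ^+ 2 -> C' * D' = e - D' ^+ 2 ->
  (elim_poly e ca sa cb sb).[t] = 0.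
Proof.
move=> hca D S D' C' hC hD hD'.
have q0 : 1 + t ^+ 2 != 0 by rewrite gt_eqF // ltr_wpDr ?sqr_ge0.
have -> : (elim_poly e ca sa cb sb).[t] = (1 + t ^+ 2) ^+ 6 *
  ((e - D ^+ 2) ^+ 2 * D' ^+ 2 + (e - D' ^+ 2) ^+ 2 * D ^+ 2
  - 2 * ca * (e - D ^+ 2) * (e - D' ^+ 2) * D * D' - sa ^+ 2 * D ^+ 2 * D' ^+ 2).
  by rewrite /elim_poly /D' /D /S !hornerE /=; field.
rewrite -hD -hD'.
have -> : (C * D) ^+ 2 * D' ^+ 2 + (C' * D') ^+ 2 * D ^+ 2 - 2 * ca * (C * D) * (C' * D') * D *
    D' -
   sa ^+ 2 * D ^+ 2 * D' ^+ 2 = D ^+ 2 * D' ^+ 2 * (C ^+ 2 * (1 - ca ^+ 2) + Sx ^+ 2 * sa ^+ 2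
       - sa ^+ 2).
  by rewrite /C'; ring.
have -> : 1 - ca ^+ 2 = sa ^+ 2 by rewrite -hca; ring.
have -> : C ^+ 2 * sa ^+ 2 + Sx ^+ 2 * sa ^+ 2 - sa ^+ 2 = (C ^+ 2 + Sx ^+ 2 - 1) * sa ^+ 2 by
    ring.
by rewrite hC subrr mul0r !mulr0.
Qed.

Lemma level_point (e : R) (s : seq (R * R)) : e != 0 -> - 4^-1 < e < 2 ->
  (forall ab, ab \in s -> ~ (sin ab.2 = 0 /\ cos ab.1 = cos ab.2)) ->
  exists x y, [/\ 0 < x < pi, 0 < cos y, cos x * cos y = e - cos y ^+ 2 &
    forall ab, ab \in s -> cos (x + ab.1) * cos (y + ab.2) != e - cos (y + ab.2) ^+ 2].
Proof.
move=> e0 /andP[e1 e2] hs.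
pose w := Num.sqrt (1 + 4 * e).
have w2 : w ^+ 2 = 1 + 4 * e by rewrite sqr_sqrtr //; lra.
have w0 : 0 < w by rewrite sqrtr_gt0; lra.
have w3 : w < 3 by rewrite ltNge; apply/negP => w3; nra.
pose D0 := `|w - 1| / 2; pose D1 := Num.min 1 ((1 + w) / 2).
have D00 : 0 <= D0 by rewrite divr_ge0.
have D01 : D0 < D1.
  have h : `|w - 1| < 2 /\ `|w - 1| < 1 + w.
    by split; rewrite ltr_norml; apply/andP; split; lra.
  by rewrite /D0 /D1 lt_min; lra.
have D11 : D1 <= 1 by rewrite /D1 ge_min lexx.
pose t0 := Num.sqrt ((1 - D1) / (1 + D1)); pose t1 := Num.sqrt ((1 - D0) / (1 + D0)).
have t01 : t0 < t1.
  rewrite /t0 /t1 ltr_sqrt; last by rewrite divr_gt0; lra.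
  rewrite ltr_pdivrMr; last by lra.
  rewrite mulrAC ltr_pdivlMr; last by lra.
  by nra.
pose G := \prod_(ab <- s) elim_poly e (cos ab.1) (sin ab.1) (cos ab.2) (sin ab.2).
have G0 : G != 0.
  rewrite prodf_seq_neq0; apply/allP => ab abs /=; apply: elim_poly_neq0 => //; try exact:
      cos2Dsin2.
  exact: hs.
have [t /andP[tt0 tt1] ht] := poly_nonroot t01 G0.
have [ct st] := half_angle t.
have tpos : 0 < t by apply: le_lt_trans tt0; exact: sqrtr_ge0.
have q0 : 0 < 1 + t ^+ 2 by rewrite ltr_wpDr ?sqr_ge0.
pose y := 2 * atan t.
have a0 : 0 <= (1 - D1) / (1 + D1) by rewrite divr_ge0; lra.
have a1 : 0 <= (1 - D0) / (1 + D0) by rewrite divr_ge0; lra.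
have yD0 : D0 < cos y.
  have : t ^+ 2 < (1 - D0) / (1 + D0).
    by rewrite -(sqr_sqrtr a1) ltrXn2r ?nnegrE ?sqrtr_ge0 // ltW.
  rewrite ltr_pdivlMr; last by lra.
  by rewrite /y ct ltr_pdivlMr //; nra.
have yD1 : cos y < D1.
  have : (1 - D1) / (1 + D1) < t ^+ 2.
    by rewrite -(sqr_sqrtr a0) ltrXn2r ?nnegrE ?sqrtr_ge0 // ltW.
  rewrite ltr_pdivrMr; last by lra.
  by rewrite /y ct ltr_pdivrMr //; nra.
have D0w : - (2 * D0) <= w - 1 <= 2 * D0.
  by rewrite -ler_norml /D0 mulrC divfK.
have D1w : cos y < (1 + w) / 2 by apply: lt_le_trans yD1 _; rewrite /D1 ge_min lexx orbT.
have cy0 : 0 < cos y by lra.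
pose C := (e - cos y ^+ 2) / cos y.
have CD : C * cos y = e - cos y ^+ 2 by rewrite divfK // gt_eqF.
have C1 : -1 < C < 1.
  rewrite /C ltr_pdivlMr // ltr_pdivrMr //.
  by move: (cos y) cy0 yD0 D1w => D hD hD0 hD1; apply/andP; split; nra.
have C1' : -1 <= C <= 1 by lra.
have cx : cos (acos C) = C by apply: acosK; rewrite in_itv.
exists (acos C), y; split => //.
- by rewrite acos_gt0 ?acos_ltpi //; lra.
- by rewrite cx.
- move=> ab abs; move: ht; rewrite horner_prod prodf_seq_neq0 => /allP/(_ ab abs) /=.
  apply: contra => /eqP h; apply/eqP.
  apply: (@elim_poly_root _ _ _ _ _ t C (sin (acos C))); rewrite -?ct -?st -/y.
  - exact: cos2Dsin2.
  - by rewrite -{1}cx; exact: cos2Dsin2.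
  - exact: CD.
  - by rewrite -cosD -{1}cx -cosD.
Qed.

End Dispersion.

Section FreeBands.
Variable R : realType.

Section Counting.
Variables (p1 p2 : nat) (hp1 : (0 < p1)%N) (hp2 : (0 < p2)%N).
Local Notation cell := (cell p1 p2).
Local Notation free_value := (@free_value R p1 p2).
Local Notation offset := (@offset R p1 p2).
Implicit Types (j : cell) (k : R * R).

Lemma angle_range (p : nat) (i : 'I_p) : 0 <= (2 * pi * i%:R / p%:R : R) < 2 * pi.
Proof.
have p0 : 0 < p%:R :> R by rewrite ltr0n (leq_ltn_trans _ (ltn_ord i)).
have pi0 : 0 < 2 * pi :> R by rewrite mulr_gt0 ?pi_gt0.
apply/andP; split; first by rewrite divr_ge0 ?(ltW p0) // mulr_ge0 ?(ltW pi0).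
by rewrite ltr_pdivrMr // ltr_pM2l // ltr_nat ltn_ord.
Qed.

Lemma angle_eq0 (p : nat) (i : 'I_p) : 2 * pi * i%:R / p%:R = 0 :> R -> i = 0%N :> nat.
Proof.
have p0 : 0 < p%:R :> R by rewrite ltr0n (leq_ltn_trans _ (ltn_ord i)).
have pi0 : 0 < pi :> R by rewrite pi_gt0.
move/eqP; rewrite mulf_eq0 invr_eq0 (gt_eqF p0) orbF !mulf_eq0 (gt_eqF pi0) pnatr_eq0 /=.
by rewrite pnatr_eq0 => /eqP.
Qed.

Definition half_offset j : R * R :=
  (((offset j).1 + (offset j).2) / 2, ((offset j).1 - (offset j).2) / 2).

Lemma half_offsetD j : (half_offset j).1 + (half_offset j).2 = (offset j).1.
Proof. by rewrite /half_offset; case: (offset j) => a b /=; field. Qed.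

Lemma half_offsetB j : (half_offset j).1 - (half_offset j).2 = (offset j).2.
Proof. by rewrite /half_offset; case: (offset j) => a b /=; field. Qed.

Lemma free_value_xy (x y : R) j : free_value (x + y, x - y) j =
  4 * cos (x + (half_offset j).1) * cos (y + (half_offset j).2) +
  4 * cos (y + (half_offset j).2) ^+ 2 - 2.
Proof.
rewrite -dispersion_xy /free_value.
rewrite -[in LHS]half_offsetD -[X in x - y + X]half_offsetB.
by case: (half_offset j) => a b /=; congr dispersion; congr pair; ring.
Qed.

Lemma half_offset_nontrivial j : j != (Ordinal hp1, Ordinal hp2) ->
  ~ (sin (half_offset j).2 = 0 /\ cos (half_offset j).1 = cos (half_offset j).2).
Proof.
move=> j0 [sb cab]; set a := (half_offset j).1; set b := (half_offset j).2.
have cb2 : cos b ^+ 2 = 1 by rewrite cos2sin2 sb expr0n subr0.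
have sa : sin a = 0.
  by apply/eqP; rewrite -sqrf_eq0 sin2cos2 cab cb2 subrr.
have o1 : (offset j).1 = a + b by rewrite half_offsetD.
have o2 : (offset j).2 = a - b by rewrite half_offsetB.
have e1 : expi (offset j).1 = 1.
  by rewrite o1 /expi cosD sinD sa sb cab !mul0r !mulr0 subr0 addr0 -expr2 cb2.
have e2 : expi (offset j).2 = 1.
  by rewrite o2 /expi cosB sinB sa sb cab !mul0r !mulr0 subr0 addr0 -expr2 cb2.
move: j0 e1 e2; rewrite /offset; case: j {a b sb cab cb2 sa o1 o2} => i1 i2 /= j0.
have r1 := angle_range i1; have r2 := angle_range i2.
move=> /expi_eq1 h1 /expi_eq1 h2; move: j0; rewrite xpair_eqE -!val_eqE /=.
rewrite (angle_eq0 (h1 _)); last by rewrite ger0_norm; case/andP: r1.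
by rewrite (angle_eq0 (h2 _)) //; rewrite ger0_norm; case/andP: r2.
Qed.

Lemma free_value_continuous_x (y : R) j : continuous (fun x : R => free_value (x + y, x - y) j).
Proof.
have -> : (fun x : R => free_value (x + y, x - y) j) = (fun x : R => 2 * cos (x + (y + (offset
    j).1)) +
    2 * cos (x + (- y + (offset j).2)) + 2 * cos (y + (offset j).1 - (- y + (offset j).2))).
  apply/funext => x; rewrite /free_value /dispersion; case: (offset j) => a b /=.
  by congr (2 * cos _ + 2 * cos _ + 2 * cos _); ring.
have cc (c : R) : continuous (fun x : R => 2 * cos (x + c)).
  move=> x; apply: cvgM; first exact: cvg_cst.
  apply: (@continuous_comp _ _ _ (fun x' => x' + c) cos); last exact: continuous_cos.
  by apply: cvgD; [exact: cvg_id|exact: cvg_cst].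
move=> x; apply: cvgD; last exact: cvg_cst.
by apply: cvgD; exact: cc.
Qed.

Lemma free_level E : -3 < E < 6 -> E != -2 ->
  exists k k', (num_le (free_value k) E < num_lt (free_value k') E)%N.
Proof.
move=> /andP[E3 E6] E2; pose e := (E + 2) / 4.
have e0 : e != 0.
  by rewrite mulf_neq0 ?invr_eq0 //; apply: contra_neq E2 => h; lra.
have e1 : - 4^-1 < e < 2 by rewrite /e; apply/andP; split; lra.
pose j0 : cell := (Ordinal hp1, Ordinal hp2).
have [|x [y [x0 cy cxy hs]]] := @level_point R e [seq half_offset j | j <- enum {: cell} & j !=
    j0] e0 e1.
  by move=> ab /mapP[j]; rewrite mem_filter => /andP[jj0 _] ->; exact: half_offset_nontrivial.
have ho0 : half_offset j0 = (0, 0).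
  by rewrite /half_offset /offset /= !mulr0 !mul0r addr0 subr0 mul0r.
have gE x' : free_value (x' + y, x' - y) j0 - E = 4 * cos y * (cos x' - cos x).
  rewrite free_value_xy ho0 /= !addr0; have -> : E = 4 * e - 2 by rewrite /e; field.
  have -> : e = cos x * cos y + cos y ^+ 2 by rewrite cxy subrK.
  by ring.
have gj j : j != j0 -> free_value (x + y, x - y) j != E.
  move=> jj0; have /hs : half_offset j \in [seq half_offset j | j <- enum {: cell} & j != j0].
    by apply: map_f; rewrite mem_filter jj0 mem_enum.
  apply: contra => /eqP; rewrite free_value_xy => h; apply/eqP.
  by rewrite /e -h; field.
pose good j (x' : R) : Prop := j != j0 ->
    if free_value (x + y, x - y) j < E then free_value (x' + y, x' - y) j < E else E <
        free_value (x' + y, x' - y) j.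
have near_ok : \forall x' \near x, forall j, good j x'.
  have ff := @filter_forall R cell good (nbhs x) (nbhs_filter x).
  apply: ff => j; have cj := @free_value_continuous_x y j x; rewrite /good.
  have [jj0|jj0] := eqVneq j j0; first by apply: nearW.
  have := gj j jj0; rewrite neq_lt => /orP[h|h].
    have : \forall x' \near x, free_value (x' + y, x' - y) j < E by apply: (cvgr_lt _ cj).
    by apply: filterS => x' hx' _; rewrite h.
  have : \forall x' \near x, E < free_value (x' + y, x' - y) j by apply: (cvgr_gt _ cj).
  by apply: filterS => x' hx' _; rewrite ltNge (ltW h).
have [h h0 hh] : exists2 h, 0 < h & forall x', `|x - x'| < h -> forall j, j != j0 ->
    if free_value (x + y, x - y) j < E then free_value (x' + y, x' - y) j < E else E <
        free_value (x' + y, x' - y) j.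
  by move/nbhs_ballP: near_ok => [h h0 hh]; exists h.
case/andP: x0 => x0 xpi.
pose m := Num.min (h / 2) (Num.min (x / 2) ((pi - x) / 2)).
have m0 : 0 < m by rewrite !lt_min !divr_gt0 ?subr_gt0.
have mh : m <= h / 2 by rewrite ge_min lexx.
have mx : m <= x / 2 by rewrite !ge_min lexx orbT.
have mp : m <= (pi - x) / 2 by rewrite !ge_min lexx !orbT.
exists ((x - m) + y, (x - m) - y), ((x + m) + y, (x + m) - y).
have hm : forall j, j != j0 -> if free_value (x + y, x - y) j < E then free_value ((x - m) + y,
    (x - m) - y) j < E
   else E < free_value ((x - m) + y, (x - m) - y) j.
  by apply: hh; rewrite opprB addrC subrK gtr0_norm //; lra.
have hp : forall j, j != j0 -> if free_value (x + y, x - y) j < E then free_value ((x + m) + y,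
    (x + m) - y) j < E
   else E < free_value ((x + m) + y, (x + m) - y) j.
  by apply: hh; rewrite opprD addrA subrr sub0r normrN gtr0_norm //; lra.
have fm : E < free_value ((x - m) + y, (x - m) - y) j0.
  rewrite -subr_gt0 gE !mulr_gt0 // subr_gt0 ltr_cos ?in_itv /=; lra.
have fp : free_value ((x + m) + y, (x + m) - y) j0 < E.
  rewrite -subr_lt0 gE pmulr_rlt0 ?mulr_gt0 // subr_lt0 ltr_cos ?in_itv /=; lra.
rewrite /num_le /num_lt; apply: proper_card; apply/properP; split.
  apply/fintype.subsetP => j; rewrite !inE => hj.
  have jj0 : j != j0 by apply: contraTneq hj => ->; rewrite -ltNge.
  have := hm j jj0; have := hp j jj0; case: ifP => // _ _.
  by rewrite ltNge hj.
by exists j0; rewrite !inE //= -ltNge.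
Qed.

Lemma free_generic : exists k, forall j, [/\ -3 < free_value k j, free_value k j < 6 &
    free_value k j != -2].
Proof.
pose a j := (half_offset j).1; pose b j := (half_offset j).2.
have [y hy] := generic_sin ([seq b j | j <- enum {: cell}] ++ [seq b j + pi / 2 | j <- enum {:
    cell}]).
have sy j : sin (y + b j) != 0.
  by apply: hy; rewrite mem_cat map_f ?mem_enum.
have cy j : cos (y + b j) != 0.
  rewrite -sinDpihalf -addrA; apply: hy; rewrite mem_cat; apply/orP; right.
  by apply/mapP; exists j; rewrite ?mem_enum.
have [X hX] := generic_sin ([seq a j / 2 | j <- enum {: cell}] ++ ([seq a j / 2 + pi / 2 | j <-
    enum {: cell}] ++
  ([seq a j / 2 + (y + b j) / 2 + pi / 2 | j <- enum {: cell}] ++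
   [seq a j / 2 - (y + b j) / 2 + pi / 2 | j <- enum {: cell}]))).
exists (2 * X + y, 2 * X - y) => j.
have s1 : sin (X + a j / 2) != 0.
  apply: hX; rewrite !mem_cat; apply/or4P; apply: Or41.
  by apply/mapP; exists j; rewrite ?mem_enum.
have s2 : cos (X + a j / 2) != 0.
  rewrite -sinDpihalf -addrA; apply: hX; rewrite !mem_cat; apply/or4P; apply: Or42.
  by apply/mapP; exists j; rewrite ?mem_enum.
have s3 : cos (X + a j / 2 + (y + b j) / 2) != 0.
  rewrite -sinDpihalf -!addrA; apply: hX; rewrite !mem_cat; apply/or4P; apply: Or43.
  by apply/mapP; exists j; rewrite ?mem_enum //; ring.
have s4 : cos (X + a j / 2 - (y + b j) / 2) != 0.
  rewrite -sinDpihalf -!addrA; apply: hX; rewrite !mem_cat; apply/or4P; apply: Or44.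
  by apply/mapP; exists j; rewrite ?mem_enum //; ring.
rewrite free_value_xy -/(a j) -/(b j); set x := 2 * X + a j; set yy := y + b j.
have sx : sin x != 0.
  have -> : x = 2 * (X + a j / 2) by rewrite /x; field.
  by rewrite sin_double !mulf_neq0.
have sx2 : cos x ^+ 2 < 1.
  by rewrite -(cos2Dsin2 x) ltrDl exprn_even_gt0 //= sx.
have sy2 : cos yy ^+ 2 < 1.
  by rewrite -(cos2Dsin2 yy) ltrDl exprn_even_gt0 //= sy.
split.
- have := sqr_ge0 (2 * cos yy + cos x); nra.
- have := sqr_ge0 (cos yy - cos x); nra.
- apply/eqP => h; have : 4 * cos yy * (cos x + cos yy) = 0 by lra.
  have -> : cos x + cos yy = 2 * (cos (X + a j / 2 + yy / 2) * cos (X + a j / 2 - yy / 2)).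
    have cos_sum (u v : R) : 2 * (cos u * cos v) = cos (u + v) + cos (u - v).
      by rewrite cosD cosB; ring.
    rewrite cos_sum; congr (cos _ + cos _); last by field.
    by rewrite /x; field.
  by apply/eqP; rewrite !mulf_neq0 // cy.
Qed.

End Counting.
End FreeBands.

Section FreeGaps.
Variable R : realType.

Section Minus2.
Variables (p1 p2 : nat) (hp1 : (0 < p1)%N) (hp2 : (0 < p2)%N).
Local Notation cell := (cell p1 p2).
Local Notation free_value := (@free_value R p1 p2).
Local Notation offset := (@offset R p1 p2).
Implicit Types (j : cell) (k : R * R).

(* Along the line [k1 = pi] the level [-2] is crossed by the [p2] shifts with
   vanishing first component, upwards or downwards according to the sign of a
   sine; when [p2] is odd the two kinds cannot balance. *)
Lemma free_minus2_odd2 : odd p2 -> exists k k', (num_le (free_value k) (-2) < num_lt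
    (free_value k') (-2))%N.
Proof.
move=> p2odd; pose i0 := Ordinal hp1.
pose o1 j := (offset j).1 / 2; pose o2 j := (offset j).2 / 2.
have [X hX] := generic_sin ([seq o2 j | j <- enum {: cell}] ++ ([seq o2 j + pi / 2 | j <- enum
    {: cell}] ++
   [seq o2 j - o1 j | j <- enum {: cell}])).
have s1 j : sin (X + o2 j) != 0 by apply: hX; rewrite mem_cat map_f ?mem_enum.
have s2 j : cos (X + o2 j) != 0.
  rewrite -sinDpihalf -addrA; apply: hX; rewrite !mem_cat; apply/or3P; apply: Or32.
  by apply/mapP; exists j; rewrite ?mem_enum.
have s3 j : sin (X + o2 j - o1 j) != 0.
  rewrite -addrA; apply: hX; rewrite !mem_cat; apply/or3P; apply: Or33.
  by apply/mapP; exists j; rewrite ?mem_enum.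
pose A (x : R) j := cos (x + o1 j).
pose G (x : R) j := cos (X + o2 j) * cos (x + (o1 j - (X + o2 j))).
have fE x j : free_value (2 * x, 2 * X) j + 2 = 8 * A x j * G x j.
  rewrite /free_value dispersion_factor /= /A /G.
  have -> : (2 * x + (offset j).1) / 2 = x + o1 j by rewrite /o1; field.
  have -> : (2 * X + (offset j).2) / 2 = X + o2 j by rewrite /o2; field.
  by rewrite -addrA.
have G0 j : G (pi / 2) j != 0.
  by rewrite /G mulf_neq0 // [pi / 2 + _]addrC cosDpihalf -opprB sinN opprK.
have A0 j : j.1 != i0 -> A (pi / 2) j != 0.
  move=> j0; rewrite /A addrC cosDpihalf oppr_eq0 gt_eqF //; apply: sin_gt0_pi.
  have /andP[r1 r2] := angle_range R j.1.
  have r0 : (offset j).1 != 0.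
    by apply: contra j0 => /eqP /angle_eq0 h; apply/eqP/val_inj.
  have : 0 < (offset j).1 by rewrite lt_def r0.
  by rewrite /o1 /= => r3; apply/andP; split; lra.
have cc (c : R) : (cos (x' + c) : R) @[x' --> (pi / 2 : R)] --> cos (pi / 2 + c).
  apply: (@continuous_comp _ _ _ (fun x' => x' + c) cos); last exact: continuous_cos.
  by apply: cvgD; [exact: cvg_id|exact: cvg_cst].
have same_sign (F : R -> R) : (F x') @[x' --> (pi / 2 : R)] --> F (pi / 2) -> F (pi / 2) != 0 ->
    \forall x' \near (pi / 2 : R), 0 < F x' * F (pi / 2).
  move=> cF F0; have cFF : (F x' * F (pi / 2)) @[x' --> (pi / 2 : R)] --> F (pi / 2) * F (pi /
      2).
    by apply: cvgM => //; exact: cvg_cst.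
  apply: (cvgr_gt _ cFF); rewrite -expr2 exprn_even_gt0 //.
have nearG : \forall x' \near (pi / 2 : R), forall j, 0 < G x' j * G (pi / 2) j.
  have ff := @filter_forall R cell (fun j x' => 0 < G x' j * G (pi / 2) j) _ (nbhs_filter (pi /
      2 : R)).
  apply: ff => j; apply: (same_sign (fun x' => G x' j)) (G0 j); apply: cvgM; first exact:
      cvg_cst.
  exact: cc.
have nearA : \forall x' \near (pi / 2 : R), forall j, j.1 != i0 -> 0 < A x' j * A (pi / 2) j.
  have ff := @filter_forall R cell (fun j x' => j.1 != i0 -> 0 < A x' j * A (pi / 2) j) _
      (nbhs_filter (pi / 2 : R)).
  apply: ff => j; have [j0|j0] := eqVneq j.1 i0; first by apply: nearW.
  have : \forall x' \near (pi / 2 : R), 0 < A x' j * A (pi / 2) j.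
    by apply: (same_sign (fun x' => A x' j)) (A0 j j0); exact: cc.
  by apply: filterS => x' h _.
have [h h0 hh] : exists2 h, 0 < h & forall x', `|pi / 2 - x'| < h ->
    (forall j, 0 < G x' j * G (pi / 2) j) /\ (forall j, j.1 != i0 -> 0 < A x' j * A (pi / 2) j).
  have near2 : \forall x' \near (pi / 2 : R), (forall j, 0 < G x' j * G (pi / 2) j) /\
      (forall j, j.1 != i0 -> 0 < A x' j * A (pi / 2) j) by exact: filterI.
  by move/nbhs_ballP: near2 => [h h0 hh]; exists h => // x' /hh[].
have pi0 := pi_gt0 R.
pose m := Num.min (h / 2) (pi / 4).
have m0 : 0 < m by rewrite lt_min !divr_gt0.
have mh : m <= h / 2 by rewrite ge_min lexx.
have mp : m <= pi / 4 by rewrite ge_min lexx orbT.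
have [Gp Ap] : (forall j, 0 < G (pi / 2 + m) j * G (pi / 2) j) /\ (forall j, j.1 != i0 -> 0 < A
    (pi / 2 + m) j * A (pi / 2) j).
  by apply: hh; rewrite opprD addrA subrr sub0r normrN gtr0_norm //; lra.
have [Gm Am] : (forall j, 0 < G (pi / 2 - m) j * G (pi / 2) j) /\ (forall j, j.1 != i0 -> 0 < A
    (pi / 2 - m) j * A (pi / 2) j).
  by apply: hh; rewrite opprB addrC subrK gtr0_norm //; lra.
have sm : 0 < sin m by apply: sin_gt0_pi; lra.
have o10 j : j.1 = i0 -> o1 j = 0 by move=> h'; rewrite /o1 /= h' /= mulr0 !mul0r.
have Ap0 j : j.1 = i0 -> A (pi / 2 + m) j < 0.
  by move=> /o10 h'; rewrite /A h' addr0 addrC cosDpihalf oppr_lt0.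
have Am0 j : j.1 = i0 -> 0 < A (pi / 2 - m) j.
  by move=> /o10 h'; rewrite /A h' addr0 addrC cosDpihalf sinN opprK.
pose kp : R * R := (2 * (pi / 2 + m), 2 * X); pose km : R * R := (2 * (pi / 2 - m), 2 * X).
have fp j : (free_value kp j < -2) = (if j.1 == i0 then 0 < G (pi / 2) j else A (pi / 2) j * G
    (pi / 2) j < 0).
  have := fE (pi / 2 + m) j; rewrite -/kp => e; have := Gp j.
  case: eqP => [/Ap0|/eqP/Ap] h1 h2; apply/idP/idP => h3; nra.
have fm j : (free_value km j < -2) = (if j.1 == i0 then G (pi / 2) j < 0 else A (pi / 2) j * G
    (pi / 2) j < 0).
  have := fE (pi / 2 - m) j; rewrite -/km => e; have := Gm j.
  case: eqP => [/Am0|/eqP/Am] h1 h2; apply/idP/idP => h3; nra.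
have nz (a b : R) : 0 < a * b -> a != 0.
  by apply: contraTneq => ->; rewrite mul0r ltxx.
have np j : free_value kp j != -2.
  rewrite -subr_eq0 opprK fE mulf_neq0 ?(nz _ _ (Gp j)) //.
  apply: mulf_neq0; first by rewrite pnatr_eq0.
  by have [/Ap0/lt_eqF ->|/Ap/nz] := eqVneq j.1 i0.
have nm j : free_value km j != -2.
  rewrite -subr_eq0 opprK fE mulf_neq0 ?(nz _ _ (Gm j)) //.
  apply: mulf_neq0; first by rewrite pnatr_eq0.
  by have [/Am0/gt_eqF ->|/Am/nz] := eqVneq j.1 i0.
have lep : num_le (free_value kp) (-2) = num_lt (free_value kp) (-2).
  by apply: eq_card => j; rewrite !inE le_eqVlt (negPf (np j)).
have lem : num_le (free_value km) (-2) = num_lt (free_value km) (-2).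
  by apply: eq_card => j; rewrite !inE le_eqVlt (negPf (nm j)).
have : num_lt (free_value kp) (-2) != num_lt (free_value km) (-2).
  rewrite /num_lt.
  rewrite -(cardID [pred j | j.1 == i0] [pred j | free_value kp j < -2]).
  rewrite -(cardID [pred j | j.1 == i0] [pred j | free_value km j < -2]).
  have -> : #|[predD [pred j | free_value kp j < -2] & [pred j | j.1 == i0]]| =
            #|[predD [pred j | free_value km j < -2] & [pred j | j.1 == i0]]|.
    by apply: eq_card => j; rewrite !inE fp fm; case: eqP.
  rewrite eqn_add2r; apply/eqP => h1.
  have : #|[pred j : cell | j.1 == i0]| = p2.
    rewrite -[RHS]card_ord -[RHS]mul1n -(card1 i0) -cardX; apply: eq_card => j.
    by rewrite !inE andbT.
  rewrite -(cardID [pred j | free_value kp j < -2]).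
  have -> : #|[predI [pred j : cell | j.1 == i0] & [pred j | free_value kp j < -2]]| =
            #|[predI [pred j | free_value km j < -2] & [pred j : cell | j.1 == i0]]|.
    by rewrite -h1; apply: eq_card => j; rewrite !inE andbC.
  have -> : #|[predD [pred j : cell | j.1 == i0] & [pred j | free_value kp j < -2]]| =
            #|[predI [pred j | free_value km j < -2] & [pred j : cell | j.1 == i0]]|.
    apply: eq_card => j; rewrite !inE fp fm; case: eqP => // _; rewrite ?andbF // !andbT.
    by rewrite -leNgt lt_neqAle G0.
  by rewrite addnn => e; move: p2odd; rewrite -e odd_double.
rewrite neq_ltn => /orP[lt|lt]; first by exists kp, km; rewrite lep.
by exists km, kp; rewrite lem.
Qed.

End Minus2.

Lemma dispersion_swap (a b : R) : dispersion (b, a) = dispersion (a, b).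
Proof. by rewrite /dispersion /= -(cosN (b - a)) opprB; ring. Qed.

Lemma num_le_swap p1 p2 (k : R * R) E : num_le (@free_value R p1 p2 k) E = num_le (@free_value
    R p2 p1 (k.2, k.1)) E.
Proof.
rewrite /num_le -!sum1_card (reindex (fun j : cell p2 p1 => (j.2, j.1))) /=; last first.
  by exists (fun j : cell p1 p2 => (j.2, j.1)) => -[].
apply: eq_bigl => j; rewrite !inE /free_value /=.
by rewrite dispersion_swap.
Qed.

Lemma num_lt_swap p1 p2 (k : R * R) E : num_lt (@free_value R p1 p2 k) E = num_lt (@free_value
    R p2 p1 (k.2, k.1)) E.
Proof.
rewrite /num_lt -!sum1_card (reindex (fun j : cell p2 p1 => (j.2, j.1))) /=; last first.
  by exists (fun j : cell p1 p2 => (j.2, j.1)) => -[].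
apply: eq_bigl => j; rewrite !inE /free_value /=.
by rewrite dispersion_swap.
Qed.

Section Overlap.
Variables (p1 p2 : nat) (hp1 : (0 < p1)%N) (hp2 : (0 < p2)%N).
Local Notation cell := (cell p1 p2).
Local Notation free_value := (@free_value R p1 p2).
Local Notation free_min := (band_min hp1 hp2 (fun=> 0 : R)).
Local Notation free_max := (band_max hp1 hp2 (fun=> 0 : R)).

Lemma free_minus2_odd : odd p1 || odd p2 ->
  exists k k', (num_le (free_value k) (-2) < num_lt (free_value k') (-2))%N.
Proof.
case/orP => [podd|podd]; last exact: (free_minus2_odd2 hp1 podd).
have [k [k' h]] := free_minus2_odd2 hp2 podd.
by exists (k.2, k.1), (k'.2, k'.1); rewrite num_le_swap num_lt_swap /=; case: k k' h => a b [].
Qed.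

Lemma free_no_level E n : (n.+1 < #|{: cell}|)%N -> free_max n <= E <= free_min n.+1 ->
  ~ exists k k', (num_le (free_value k) E < num_lt (free_value k') E)%N.
Proof.
move=> nP /andP[hE El] [k [k' lt]]; have nP' := ltnW nP.
have h1 : (n < num_le (free_value k) E)%N.
  apply: (free_count_le (hp1 := hp1) (hp2 := hp2) nP'); apply: le_trans _ hE.
  have [_ h] := band_maxP hp1 hp2 (fun=> 0 : R) nP'; exact: h.
have h2 : (num_lt (free_value k') E <= n.+1)%N.
  apply: (free_count_lt (hp1 := hp1) (hp2 := hp2) nP); apply: le_trans El _.
  have [_ h] := band_minP hp1 hp2 (fun=> 0 : R) nP; exact: h.
by have := leq_trans h1 (leq_trans (ltnW lt) h2); lia.
Qed.

Lemma free_generic_band : exists k, forall n, (n < #|{: cell}|)%N ->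
  [/\ -3 < band hp1 hp2 (fun=> 0) k n, band hp1 hp2 (fun=> 0) k n < 6 & band hp1 hp2 (fun=> 0)
      k n != -2 :> R].
Proof.
have [k hk] := free_generic R p1 p2; exists k => n nP.
rewrite band_free //; have [j ->] := sorted_value_mem (free_value k) nP; exact: hk.
Qed.

Lemma free_overlap n : (n.+1 < #|{: cell}|)%N ->
  free_min n.+1 < free_max n \/ [/\ free_max n = -2, free_min n.+1 = -2 & ~~ (odd p1 || odd
      p2)].
Proof.
move=> nP; have nP' := ltnW nP; have [//|hl] := ltP (free_min n.+1) (free_max n); first by left.
right; have [k hk] := free_generic_band.
have [h3 _ _] := hk n nP'; have [_ h6 _] := hk n.+1 nP.
have hlo : -3 < free_max n.
  by apply: lt_le_trans h3 _; have [_ h] := band_maxP hp1 hp2 (fun=> 0 : R) nP'; exact: h.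
have hhi : free_min n.+1 < 6.
  by apply: le_lt_trans h6; have [_ h] := band_minP hp1 hp2 (fun=> 0 : R) nP; exact: h.
have level E : free_max n <= E <= free_min n.+1 -> E = -2.
  move=> hE; apply/eqP/negPn/negP => E2; apply: (free_no_level nP hE).
  by apply: free_level => //; case/andP: hE => h1 h2; rewrite (lt_le_trans hlo h1) (le_lt_trans
      h2 hhi).
have e1 : free_max n = -2 by apply: level; rewrite lexx.
have e2 : free_min n.+1 = -2 by apply: level; rewrite lexx andbT.
split => //; apply/negP => /free_minus2_odd; apply: (free_no_level nP).
by rewrite e1 e2 lexx.
Qed.

End Overlap.
End FreeGaps.

(** * Perturbation of the free bands *)

Section Assembly.
Variable R : realType.
Local Notation C := R[i].
Local Notation V := (int * int)%type.

Lemma real_intervalP (G : set R) a b t : connected G -> G a -> G b -> a <= t <= b -> G t.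
Proof. by move=> /connected_intervalP cG Ga Gb; exact: cG. Qed.

Lemma segment_mem (a b x : R) : (segment a b) x%:C <-> a <= x <= b.
Proof.
split => [[y] /= hy [<-]|h]; first by move: hy; rewrite in_itv.
by exists x => //=; rewrite in_itv.
Qed.

Lemma component_unbounded_below (A : set R) a x : x < a -> (forall y, y < a -> A y) ->
  ~ bounded_set (connected_component A x).
Proof.
move=> xa hA; rewrite /= /bounded_near => /filter_ex[M hM].
have sub : [set y | y < a] `<=` connected_component A x.
  apply: connected_component_max => //.
  by apply/connected_intervalP => u v /= _ va w /andP[_ wv]; exact: le_lt_trans wv va.
pose y := Num.min x (- M - 1).
have : `|y| <= M.
  apply: hM; apply: sub => /=; apply: le_lt_trans xa.
  by rewrite ge_min lexx.
have : y <= - M - 1 by rewrite ge_min lexx orbT.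
by rewrite ler_norml => h /andP[]; lra.
Qed.

Lemma component_unbounded_above (A : set R) a x : a < x -> (forall y, a < y -> A y) ->
  ~ bounded_set (connected_component A x).
Proof.
move=> xa hA; rewrite /= /bounded_near => /filter_ex[M hM].
have sub : [set y | a < y] `<=` connected_component A x.
  apply: connected_component_max => //.
  by apply/connected_intervalP => u v /= ua _ w /andP[uw _]; exact: lt_le_trans ua uw.
pose y := Num.max x (M + 1).
have : `|y| <= M.
  apply: hM; apply: sub => /=; apply: lt_le_trans xa _.
  by rewrite le_max lexx.
have : M + 1 <= y by rewrite le_max lexx orbT.
by rewrite ler_norml => h /andP[]; lra.
Qed.

Lemma sup_norm_le (Q : V -> R) (c : R) : (sup_norm Q <= c%:E)%E -> forall u, `|Q u| <= c.
Proof.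
move=> h u; rewrite -lee_fin; apply: le_trans h; apply: ereal_sup_ubound.
by exists u.
Qed.

Variables (p1 p2 : nat) (hp1 : (0 < p1)%N) (hp2 : (0 < p2)%N).
Local Notation P := #|{: cell p1 p2}|.
Local Notation band_min := (band_min hp1 hp2).
Local Notation band_max := (band_max hp1 hp2).
Local Notation zero := (fun=> 0 : R).
Implicit Types Q : V -> R.

Let P0 : (0 < P)%N. Proof. by rewrite card_prod !card_ord muln_gt0 hp1. Qed.
Let PP : (P.-1 < P)%N. Proof. by rewrite prednK. Qed.

Lemma bands_cover Q m n x : (m <= n < P)%N ->
  (forall i, (m <= i < n)%N -> band_min Q i.+1 <= band_max Q i) ->
  band_min Q m <= x <= band_max Q n -> exists2 i, (i < P)%N & band_min Q i <= x <= band_max Q i.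
Proof.
move=> /andP[mn nP]; elim: n mn nP => [|n IH] mn nP hov /andP[h1 h2].
  by exists 0%N => //; move: mn h1; rewrite leqn0 => /eqP -> ->.
move: mn; rewrite leq_eqVlt => /orP[/eqP e|mn].
  by exists n.+1 => //; rewrite -{1}e h1.
have [xn|xn] := leP x (band_max Q n).
  apply: IH; rewrite ?h1 //; first exact: ltnW.
  by move=> i /andP[mi ni]; apply: hov; rewrite mi (ltn_trans ni).
exists n.+1 => //; rewrite h2 andbT (le_trans _ (ltW xn)) // hov //.
by rewrite leqnn andbT -ltnS.
Qed.

Lemma free_extent : band_min zero 0%N < band_max zero P.-1.
Proof.
have [k hk] := free_generic_band R hp1 hp2.
have [_ h6 _] := hk 0%N P0.
have [_ hlo] := band_minP hp1 hp2 zero P0.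
pose j0 : cell p1 p2 := (Ordinal hp1, Ordinal hp2).
have [n nP hn] := mem_sorted_value (@free_value R p1 p2 (0, 0)) j0.
have f6 : free_value (0, 0) j0 = 6 :> R.
  by rewrite /free_value /dispersion /= !mulr0 !mul0r !addr0 subr0 cos0; ring.
have [_ hhi] := band_maxP hp1 hp2 zero nP.
apply: le_lt_trans (hlo k) _; apply: lt_le_trans h6 _; rewrite -f6 -hn -(band_free hp1 hp2) //.
apply: le_trans (hhi _) _; apply: band_max_mono; rewrite PP andbT -ltnS prednK //.
Qed.

(* Two gaps at the energy -2 would force a flat band in between. *)
Lemma free_structure :
  (forall n, (n.+1 < P)%N -> band_min zero n.+1 < band_max zero n) \/
  exists g, [/\ (g.+1 < P)%N, ~~ (odd p1 || odd p2), band_max zero g = -2 /\ band_min zero g.+1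
      = -2,
    band_min zero 0%N < band_max zero g /\ band_min zero g.+1 < band_max zero P.-1
  & forall n, (n.+1 < P)%N -> n != g -> band_min zero n.+1 < band_max zero n].
Proof.
have [|/existsNP[g /not_implyP[gP ng]]] :=
  pselect (forall n, (n.+1 < P)%N -> band_min zero n.+1 < band_max zero n); first by left.
right; exists g; have gP' := ltnW gP.
have [//|[hg lg even]] := @free_overlap R p1 p2 hp1 hp2 g gP.
have [k hk] := free_generic_band R hp1 hp2.
have below m : (m < P)%N -> band_max zero m = -2 -> band hp1 hp2 zero k m < -2.
  move=> mP hm; have [_ _ m2] := hk m mP; rewrite lt_neqAle m2 /= -hm.
  by have [_ h] := band_maxP hp1 hp2 zero mP; exact: h.
have above m : (m < P)%N -> band_min zero m = -2 -> -2 < band hp1 hp2 zero k m.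
  move=> mP hm; have [_ _ m2] := hk m mP; rewrite lt_neqAle eq_sym m2 /= -hm.
  by have [_ h] := band_minP hp1 hp2 zero mP; exact: h.
split => //.
- split.
    rewrite hg; apply: le_lt_trans (below g gP' hg); apply: (@le_trans _ _ (band hp1 hp2 zero k
        0%N)).
      by have [_ h] := band_minP hp1 hp2 zero P0; exact: h.
    by apply: band_mono; rewrite leq0n.
  rewrite lg; apply: lt_le_trans (above g.+1 gP lg) _; apply: (@le_trans _ _ (band hp1 hp2 zero
      k P.-1)).
    by apply: band_mono; rewrite PP andbT -ltnS prednK.
  by have [_ h] := band_maxP hp1 hp2 zero PP; exact: h.
- move=> n nP; rewrite neq_ltn => ng'.
  have [//|[hn ln _]] := @free_overlap R p1 p2 hp1 hp2 n nP; have nP' := ltnW nP.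
  case/orP: ng' => lt.
    have := le_lt_trans (band_mono hp1 hp2 zero k (_ : (n.+1 <= g < P)%N)) (below g gP' hg).
    rewrite lt gP' => /(_ isT) h; have := above n.+1 nP ln.
    by rewrite ltNge (ltW h).
  have := lt_le_trans (above g.+1 gP lg) (band_mono hp1 hp2 zero k (_ : (g.+1 <= n < P)%N)).
  rewrite lt nP' => /(_ isT) h; have := below n nP' hn.
  by rewrite ltNge (ltW h).
Qed.

Lemma margin : exists2 c : R, 0 < c & forall Q (d : R), d <= c -> (forall u, `|Q u| <= d) ->
  forall n, (n < P)%N ->
  [/\ (n.+1 < P)%N -> band_min zero n.+1 < band_max zero n -> band_min Q n.+1 <= band_max Q n,
    band_min zero 0%N < band_max zero n -> band_min Q 0%N < band_max Q n
  & band_min zero n < band_max zero P.-1 -> band_min Q n < band_max Q P.-1].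
Proof.
have half (x y : R) : exists2 c, 0 < c & x < y -> x + c < y - c.
  have [xy|xy] := ltP x y; last by exists 1.
  by exists ((y - x) / 3); [rewrite divr_gt0 // subr_gt0|move=> _; lra].
have [| |c c0 hc] := @common_positive R P (fun n c =>
  [/\ band_min zero n.+1 < band_max zero n -> band_min zero n.+1 + c < band_max zero n - c,
      band_min zero 0%N < band_max zero n -> band_min zero 0%N + c < band_max zero n - c
    & band_min zero n < band_max zero P.-1 -> band_min zero n + c < band_max zero P.-1 - c]).
- move=> n d d' /andP[_ dd] [h1 h2 h3].
  by split => [/h1|/h2|/h3]; lra.
- move=> n nP.
  have [c1 p1' h1] := half (band_min zero n.+1) (band_max zero n).
  have [c2 p2' h2] := half (band_min zero 0%N) (band_max zero n).
  have [c3 p3' h3] := half (band_min zero n) (band_max zero P.-1).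
  pose m := Num.min c1 (Num.min c2 c3).
  have m1 : m <= c1 by rewrite ge_min lexx.
  have m2 : m <= c2 by rewrite !ge_min lexx orbT.
  have m3 : m <= c3 by rewrite !ge_min lexx !orbT.
  exists m; first by rewrite !lt_min p1' p2' p3'.
  by split => [/h1|/h2|/h3]; lra.
exists c => // Q d dc hQ n nP.
have hQ' u : `|Q u - 0| <= c by rewrite subr0 (le_trans (hQ u)).
have [h1 h2 h3] := hc n nP; split.
- move=> nP' /h1 h; have := band_min_perturb hp1 hp2 (Q := zero) nP' hQ'.
  by have := band_max_perturb hp1 hp2 (Q := zero) nP hQ'; lra.
- move=> /h2 h; have := band_min_perturb hp1 hp2 (Q := zero) P0 hQ'.
  by have := band_max_perturb hp1 hp2 (Q := zero) nP hQ'; lra.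
- move=> /h3 h; have := band_min_perturb hp1 hp2 (Q := zero) nP hQ'.
  by have := band_max_perturb hp1 hp2 (Q := zero) PP hQ'; lra.
Qed.

Section Spectrum.
Variables (Q : V -> R) (q : R).
Hypotheses (Qq : forall u, `|Q u| <= q) (Qp : tri_periodic p1 p2 Q).
Local Notation S := (spectrum (schrodinger Q)).

Lemma spectrum_segment m n : (m <= n < P)%N ->
  (forall i, (m <= i < n)%N -> band_min Q i.+1 <= band_max Q i) ->
  forall x, band_min Q m <= x <= band_max Q n -> S x%:C.
Proof.
move=> mn hov x hx; have [i iP hi'] := bands_cover mn hov hx.
by apply/(spectrumE hp1 hp2 _ Qq Qp); exists x, i.
Qed.

Lemma band_segment m n i x : (m <= i <= n)%N -> (n < P)%N -> band_min Q i <= x <= band_max Q i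
    ->
  band_min Q m <= x <= band_max Q n.
Proof.
move=> /andP[mi in_] nP /andP[h1 h2]; rewrite (le_trans _ h1) ?(le_trans h2) //.
  by apply: band_max_mono; rewrite in_.
by apply: band_min_mono; rewrite mi (leq_ltn_trans in_).
Qed.

Lemma one_interval : (forall n, (n.+1 < P)%N -> band_min Q n.+1 <= band_max Q n) ->
  S = segment (band_min Q 0%N) (band_max Q P.-1).
Proof.
move=> hov; apply/seteqP; split => w.
  move=> /(spectrumE hp1 hp2 _ Qq Qp)[x [n [-> nP hx]]]; apply/segment_mem.
  by apply: (@band_segment _ _ n) => //; rewrite leq0n -ltnS prednK.
move=> [x hx <-]; apply: (@spectrum_segment 0%N P.-1); rewrite ?PP //.
  by move=> i /andP[_ iP]; apply: hov; rewrite -ltn_predRL.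
Qed.

Lemma two_intervals g : (g.+1 < P)%N ->
  (forall n, (n.+1 < P)%N -> n != g -> band_min Q n.+1 <= band_max Q n) ->
  S = segment (band_min Q 0%N) (band_max Q g) `|` segment (band_min Q g.+1) (band_max Q P.-1).
Proof.
move=> gP hov; have gP' := ltnW gP; apply/seteqP; split => w.
  move=> /(spectrumE hp1 hp2 _ Qq Qp)[x [n [-> nP hx]]].
  have [ng|gn] := leqP n g.
    by left; apply/segment_mem; apply: (@band_segment _ _ n); rewrite ?ng.
  by right; apply/segment_mem; apply: (@band_segment _ _ n) => //; rewrite gn -ltnS prednK.
case=> -[x hx <-].
  apply: (@spectrum_segment 0%N g) => // i /andP[_ ig]; apply: hov; last by rewrite ltn_eqF.
  exact: leq_trans gP'.
apply: (@spectrum_segment g.+1 P.-1) => //.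
  by rewrite PP andbT -ltnS prednK.
move=> i /andP[gi iP]; apply: hov; last by rewrite gtn_eqF.
by rewrite -ltn_predRL.
Qed.

End Spectrum.
End Assembly.

Theorem theorem1p1 (R : realType) (p1 p2 : nat) (hp1 : (0 < p1)%N)
  (hp2 : (0 < p2)%N) :
  exists c : R, 0 < c /\
    (forall Q : tri_vertex -> R, tri_periodic p1 p2 Q -> (sup_norm Q <= c%:E)%E ->
       at_most_two_intervals (spectrum (schrodinger Q)) /\
       (odd p1 || odd p2 -> is_one_interval (spectrum (schrodinger Q)))) /\
    (forall eps : R, 0 < eps ->
       exists delta : R, 0 < delta <= c /\
         forall Q : tri_vertex -> R, tri_periodic p1 p2 Q ->
           (sup_norm Q <= delta%:E)%E ->
           forall x : R, real_complement (spectrum (schrodinger Q)) x ->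
             let G := connected_component
                        (real_complement (spectrum (schrodinger Q))) x in
             bounded_set G -> G `<=` `](-2 - eps), (-2 + eps)[).
Proof.
have P0 : (0 < #|{: cell p1 p2}|)%N by rewrite card_prod !card_ord muln_gt0 hp1.
have PP : (#|{: cell p1 p2}|.-1 < #|{: cell p1 p2}|)%N by rewrite prednK.
have [c c0 hc] := margin R hp1 hp2; exists c; split => //.
have ext := free_extent R hp1 hp2; have str := free_structure R hp1 hp2.
split => [Q Qp /sup_norm_le Qc|eps eps0].
  have mar := hc Q c (lexx c) Qc.
  have ext' : band_min hp1 hp2 Q 0 < band_max hp1 hp2 Q #|{: cell p1 p2}|.-1.
    by have [_ h _] := mar _ PP; exact: h.
  case: str => [ov|[g [gP even _ [l1 l2] ov]]].
    have E := one_interval Qc Qp (hp1 := hp1) (hp2 := hp2).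
    have {}E : spectrum (schrodinger Q) = segment (band_min hp1 hp2 Q 0) (band_max hp1 hp2 Q
        #|{: cell p1 p2}|.-1).
      by apply: E => n nP; have [h _ _] := mar n (ltnW nP); exact: h nP (ov n nP).
    split => [|_]; last by do 2!eexists; split; [exact: ext'|exact: E].
    by do 4!eexists; split; [exact: ext'|exact: ext'|rewrite setUid; exact: E].
  split; last by rewrite (negPf even).
  do 4!eexists; split; last first.
  - apply: (two_intervals Qc Qp gP (hp1 := hp1) (hp2 := hp2)) => n nP ng.
    by have [h _ _] := mar n (ltnW nP); exact: h nP (ov n nP ng).
  - by have [_ _ h] := mar g.+1 gP; exact: h.
  - by have [_ h _] := mar g (ltnW gP); exact: h.
exists (Num.min c (eps / 2)); split; first by rewrite lt_min c0 divr_gt0 //= ge_min lexx.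
move=> Q Qp /sup_norm_le Qd x; set A := real_complement _; move=> Sx G bG y Gy.
set delta := Num.min c (eps / 2) in Qd.
have dc : delta <= c by rewrite ge_min lexx.
have de : delta <= eps / 2 by rewrite ge_min lexx orbT.
have mar := hc Q delta dc Qd.
have GA : G `<=` A by exact: connected_component_sub.
have Gx : G x by exact: connected_component_refl.
have cG : connected G by exact: component_connected.
have spec w : spectrum (schrodinger Q) w <-> exists x n,
    [/\ w = x%:C, (n < #|{: cell p1 p2}|)%N & band_min hp1 hp2 Q n <= x <= band_max hp1 hp2 Q
        n].
  exact: spectrumE Qd Qp.
have xlo : band_min hp1 hp2 Q 0 <= x.
  rewrite leNgt; apply/negP => xl; apply: (component_unbounded_below xl _ bG) => t tl.
  move=> /spec[t' [n [/complexI <- nP /andP[h _]]]].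
  have := band_min_mono hp1 hp2 Q (_ : (0 <= n < _)%N); rewrite nP => /(_ isT).
  by rewrite leNgt (le_lt_trans h tl).
have xhi : x <= band_max hp1 hp2 Q #|{: cell p1 p2}|.-1.
  rewrite leNgt; apply/negP => xh; apply: (component_unbounded_above xh _ bG) => t th.
  move=> /spec[t' [n [/complexI <- nP /andP[_ h]]]].
  have := band_max_mono hp1 hp2 Q (_ : (n <= #|{: cell p1 p2}|.-1 < _)%N).
  rewrite PP andbT -ltnS prednK // => /(_ nP).
  by rewrite leNgt (lt_le_trans th h).
case: str => [ov|[g [gP _ [hg lg] _ ov]]].
  case: Sx; rewrite (one_interval Qd Qp (hp1 := hp1) (hp2 := hp2)).
    by apply/segment_mem; rewrite xlo xhi.
  by move=> n nP; have [h _ _] := mar n (ltnW nP); exact: h nP (ov n nP).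
have gP' := ltnW gP.
have S2 : spectrum (schrodinger Q) = segment (band_min hp1 hp2 Q 0) (band_max hp1 hp2 Q g) `|`
    segment (band_min hp1 hp2 Q g.+1) (band_max hp1 hp2 Q #|{: cell p1 p2}|.-1).
  apply: (two_intervals Qd Qp gP (hp1 := hp1) (hp2 := hp2)) => n nP ng.
  by have [h _ _] := mar n (ltnW nP); exact: h nP (ov n nP ng).
have xg : band_max hp1 hp2 Q g < x.
  rewrite ltNge; apply/negP => h; apply: Sx; rewrite S2; left; apply/segment_mem.
  by rewrite xlo h.
have xg' : x < band_min hp1 hp2 Q g.+1.
  rewrite ltNge; apply/negP => h; apply: Sx; rewrite S2; right; apply/segment_mem.
  by rewrite h xhi.
have Qd' u : `|Q u - 0| <= delta by rewrite subr0.
have hgQ := band_max_perturb hp1 hp2 (Q := fun=> 0) gP' Qd'.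
have lgQ := band_min_perturb hp1 hp2 (Q := fun=> 0) gP Qd'.
have yg : band_max hp1 hp2 Q g < y.
  rewrite ltNge; apply/negP => h.
  have : A (band_max hp1 hp2 Q g) by apply: GA; apply: (real_intervalP cG Gy Gx); rewrite h ltW.
  by apply; apply/spec; exists (band_max hp1 hp2 Q g), g; split => //; rewrite lexx
      band_min_le_max.
have yg' : y < band_min hp1 hp2 Q g.+1.
  rewrite ltNge; apply/negP => h.
  have : A (band_min hp1 hp2 Q g.+1) by apply: GA; apply: (real_intervalP cG Gx Gy); rewrite h
      ltW.
  by apply; apply/spec; exists (band_min hp1 hp2 Q g.+1), g.+1; split => //; rewrite lexx
      band_min_le_max.
rewrite /= in_itv /=; apply/andP; split; lra.
Qed.
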